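(* There exists a constant $C$ such that the Poincaré inequality $$\iint_{HB(0,r)}|w-\bar w|\,dx\,dy\le Cr\iint_{HB(0,r)}|\nabla_Aw|\,dx\,dy$$ holds for any Lipschitz function $w$ and all sufficiently small $r>0$, where $\bar w=\frac{1}{|HB(0,r)|}\iint_{HB(0,r)}w\,dx\,dy$.
   Context: $f$ is an even function on $\mathbb{R}$ with $f(0)=0$, $f(x)=e^{-F(|x|)}$ for $0<|x|<R$, where $F$ is twice differentiable on $(0,R)$ and, for some constants $C\ge1$, $\varepsilon>0$: (1) $\lim_{x\to0^+}F(x)=+\infty$; (2) $F'<0$ and $F''>0$ on $(0,R)$; (3) $\frac1C|F'(r)|\le|F'(x)|\le C|F'(r)|$ for $\frac12r<x<2r<R$; (4) $\frac{1}{-xF'(x)}$ is increasing on $(0,R)$ and bounded by $\frac1\varepsilon$; (5) $\frac{F''(x)}{-F'(x)}\approx\frac1x$ on $(0,R)$. $B(0,r)$ is the ball centered at the origin of radius $r$ in the control metric $dt^2=dx^2+\frac1{f(x)^2}dy^2$ on $\mathbb{R}^2$; $HB(0,r)=B(0,r)\cap\{(x,y)\in\mathbb{R}^2:x>0\}$; $\nabla_Aw=\left(\frac{\partial w}{\partial x},f(x)\frac{\partial w}{\partial y}\right)$. *)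

(* Defs.v *)
From HB Require Import structures.
From mathcomp Require Import all_boot all_order all_algebra.
From mathcomp Require Import all_classical all_reals all_analysis.
Import Order.TTheory GRing.Theory Num.Theory.
Import numFieldNormedType.Exports.

Set Implicit Arguments.
Unset Strict Implicit.
Unset Printing Implicit Defensive.

Local Open Scope ring_scope.
Local Open Scope classical_set_scope.

(* The length element of dt^2 = dx^2 + dy^2 / f(x)^2 at abscissa x, for the
   velocity v. Where f vanishes, a velocity with nonzero y-component has
   infinite length; the first branch is needed because 0^-1 = 0. *)
Definition arc_speed (R : realType) (f : R -> R) (x : R) (v : R * R) : \bar R :=
  if (f x == 0) && (v.2 != 0) then +oo%E
  else (Num.sqrt (v.1 ^+ 2 + (v.2 / f x) ^+ 2))%:E.

(* Only used for g Lipschitz on [0, 1], whose velocity exists almost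
   everywhere; derive1 takes a default value elsewhere. *)
Definition curve_length (R : realType) (f : R -> R) (g : R -> R * R) : \bar R :=
  (\int[lebesgue_measure]_(t in `[0%R, 1%R])
    arc_speed f (g t).1
      (derive1 (fun s => (g s).1) t, derive1 (fun s => (g s).2) t))%E.

Definition control_dist (R : realType) (f : R -> R) (p q : R * R) : \bar R :=
  ereal_inf [set curve_length f g | g in
    [set g : R -> R * R |
      [/\ [lipschitz g t | t in `[0%R, 1%R]], g 0 = p & g 1 = q]]].

Definition control_ball (R : realType) (f : R -> R) (p : R * R) (r : R) :
    set (R * R) :=
  [set q | (control_dist f p q < r%:E)%E].

Definition half_ball (R : realType) (f : R -> R) (r : R) : set (R * R) :=
  control_ball f (0, 0) r `&` [set p | 0 < p.1].

Definition gradA (R : realType) (f : R -> R) (w : R * R -> R) (p : R * R) :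
    R * R :=
  (derive1 (fun x => w (x, p.2)) p.1, f p.1 * derive1 (fun y => w (p.1, y)) p.2).

(* The norm of the library on R * R is the sup norm. *)
Definition euclid_norm (R : realType) (v : R * R) : R :=
  Num.sqrt (v.1 ^+ 2 + v.2 ^+ 2).

Notation lebesgue2 R :=
  (@lebesgue_measure R \x @lebesgue_measure R)%E (only parsing).

Definition average (R : realType) (D : set (R * R)) (w : R * R -> R) : R :=
  (fine (lebesgue2 R D))^-1 * \int[lebesgue2 R]_(p in D) w p.

(* Main.v *)
(* Put [k = - F']. Convexity of [F] puts [f] below its tangent exponentials, and
   the bounds on [F'] and [F''] make [1 / k] Lipschitz with [1 / k x <= x / eps].
   They yield an interval [a', a] inside [0, r] of length comparable to
   [1 / k r] on which [f] is comparable to [f r]. The half ball has height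
   [<= 3 * f r / k r], it is stable under contracting [y], and a point of it may be
   moved right up to abscissa [a], or left down to [a'] once its height is divided
   by a constant. So every point is joined to [(s, 0)], for [a' < s < a], by one
   horizontal and at most two vertical segments; integrating the fundamental
   theorem of calculus along them and averaging over [s] bounds the oscillation
   by the integrals of [|dw/dx|] over horizontal lines (of length at most [r])
   and of [|dw/dy| <= |f dw/dy| / f a'] over vertical ones, where the factor
   [height * r / ((a - a') * f a')] is of order [r]. *)
Require Import Defs.
From HB Require Import structures.
From mathcomp Require Import all_boot all_order all_algebra.
From mathcomp Require Import all_classical all_reals all_analysis.
From mathcomp Require Import measurable_realfun ring lra.
Import Order.TTheory GRing.Theory Num.Theory.
Import numFieldNormedType.Exports.

Set Implicit Arguments.
Unset Strict Implicit.
Unset Printing Implicit Defensive.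

Local Open Scope ring_scope.
Local Open Scope classical_set_scope.

(** * Lipschitz functions and measurability of partial derivatives *)

(** The half ball is never described explicitly: a point is known only through a curve that reaches
    it. Most stability properties follow one pattern: a new curve is made from a given one so that
    its speed is almost everywhere at most a constant times the old speed. That constant is 1 except
    for openness, where the strict inequality between length and [r] leaves room. Speeds are
    compared through increments, because truncations by min and max have kinks.

    The delicate move is the one to the right. A curve that stays left of abscissa [x] is discarded
    for a detour through some [z] beyond [x] where [f] is at least 4 times [f x]: the height,
    bounded by a hyperbolic comparison, is then cheap to climb. This fixes the size [A / k a] of
    [r - a]: large enough to contain such a [z], yet of the order of [1 / k], so that [f] varies
    only by a bounded factor up to [r]. *)

Lemma ler_dist_max (R : realDomainType) (a b c : R) :
  `|Num.max a c - Num.max b c| <= `|a - b|.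
Proof.
wlog ab : a b / a <= b.
  by move=> H; have [/H//|/ltW/H] := leP a b; rewrite distrC (distrC b).
rewrite distrC (distrC a) !ger0_norm ?subr_ge0//; last by rewrite ge_max !le_max ab lexx orbT.
by rewrite /Num.max; case: ltP => ?; case: ltP => ?; lra.
Qed.

Lemma ler_dist_min (R : realDomainType) (a b c : R) :
  `|Num.min a c - Num.min b c| <= `|a - b|.
Proof.
have := ler_dist_max (- a) (- b) (- c).
by rewrite -!oppr_min -!opprD !normrN.
Qed.

(** Lipschitz on the whole line with an explicit constant: curves are extended beyond [[0, 1]], so
    that no domain has to be carried along. *)
Definition klip (R : realType) (K : R) (h : R -> R) :=
  forall s t, `|h s - h t| <= K * `|s - t|.

Lemma klip_continuous (R : realType) (K : R) (h : R -> R) :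
  klip K h -> continuous h.
Proof.
move=> hK x; apply/cvgrPdist_le => /= e e0.
have K1 : 0 < `|K| + 1 by rewrite ltr_wpDl.
near=> y.
apply: (le_trans (hK _ _)); apply: (@le_trans _ _ ((`|K| + 1) * `|x - y|)).
  by rewrite ler_wpM2r// (le_trans (ler_norm _))// lerDl.
rewrite -ler_pdivlMl// mulrC; near: y.
have : 0 < e / (`|K| + 1) by rewrite divr_gt0.
move=> d0; exists (e / (`|K| + 1)) => //= z /=; exact: ltW.
Unshelve. all: by end_near. Qed.

(** Both sides are infima over countable covers by half-open intervals, which the hypothesis
    compares interval by interval. This gives absolute continuity below. *)
Lemma lebesgue_stieltjes_le (R : realType) (m : cumulative R R) (c : R) :
  0 < c -> (forall a b, a <= b -> m b - m a <= c * (b - a)) ->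
  forall A, (lebesgue_stieltjes_measure m A <= c%:E * lebesgue_measure A)%E.
Proof.
move=> c0 mc A.
have mono B : ocitv B ->
    (wlength m B <= c%:E * wlength (idfun : R -> R) B)%E.
  move=> /ocitvP[->|[[a b] /= ab ->]]; first by rewrite !wlength0 mule0.
  rewrite !wlength_itv_bnd ?(ltW ab)//.
  by rewrite -EFinM lee_fin; apply: mc; exact: ltW.
rewrite /lebesgue_measure /lebesgue_stieltjes_measure /measure_extension /mu_ext.
rewrite -ereal_inf_pZl//; apply: le_ereal_inf_tmp => _ [_ [F AF <-] <-].
apply: ge_ereal_inf; eexists; first by exists F.
rewrite -nneseriesZl; last first.
  by move=> i _; exact: (@wlength_ge0 R idfun).
apply: lee_nneseries => [i _ _|i _]; first exact: wlength_ge0.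
by apply: mono; exact: (cover_measurable AF).
Qed.

Lemma klipW (R : realType) (K K' : R) (h : R -> R) :
  K <= K' -> klip K h -> klip K' h.
Proof.
by move=> KK' hK s t; apply: (le_trans (hK s t)); rewrite ler_wpM2r.
Qed.

(** The Stieltjes measure of [m] is at most [c] times Lebesgue measure, hence absolutely continuous;
    [g] is its Radon-Nikodym derivative. *)
Lemma lipschitz_nondecreasing_density (R : realType) (c a b : R) (m : R -> R) :
  0 < c -> a < b -> (forall s t, s <= t -> 0 <= m t - m s <= c * (t - s)) ->
  exists g : R -> R, [/\ lebesgue_measure.-integrable setT (EFin \o g),
     (forall x, 0 <= g x) &
     forall x, a <= x <= b ->
       (\int[lebesgue_measure]_(t in `]a, x]) (g t)%:E = (m x - m a)%:E)%E].
Proof.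
move=> c0 ab mc.
have ndm : nondecreasing m.
  by move=> s t st; rewrite -subr_ge0; case/andP: (mc _ _ st).
have lm : klip c m.
  move=> s t; have [st|ts] := leP s t.
    by rewrite distrC (distrC s) !ger0_norm ?subr_ge0//; [case/andP: (mc _ _ st)|exact: ndm].
  by rewrite !ger0_norm ?subr_ge0 ?(ltW ts)//; [case/andP: (mc _ _ (ltW ts))|exact: ndm (ltW _)].
have rcm : right_continuous m by apply: right_continuousW; exact: klip_continuous lm.
have [M Mm] : exists M : cumulative R R, M = m :> (R -> R).
  pose M : cumulative R R := HB.pack m (isCumulative.Build R _ R m ndm rcm).
  by exists M.
rewrite -Mm {m rcm Mm} in mc ndm lm *.
have Mab x y : x <= y -> lebesgue_stieltjes_measure M `]x, y]%classic = (M y - M x)%:E.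
  move=> xy; rewrite /lebesgue_stieltjes_measure /measure_extension/=.
  by rewrite measurable_mu_extE//=; [rewrite wlength_itv_bnd|exact: is_ocitv].
have mD : measurable (`]a, b]%classic : set (measurableTypeR R)) by exact: measurable_itv.
have DM : (lebesgue_stieltjes_measure M `]a, b]%classic < +oo)%E.
  by rewrite Mab ?ltW// ltry.
(* Restricting to []a, b]] gives a finite measure, as the Radon-Nikodym theorem asks. *)
pose nu : {finite_measure set (measurableTypeR R) -> \bar R} := mfrestr mD DM.
have [|g [g0 gfin intg gE]] :=
  @radon_nikodym_sigma_finite _ _ R lebesgue_measure nu.
  apply/null_content_dominatesP => A mA A0 /=.
  apply/eqP; rewrite eq_le measure_ge0 andbT /mfrestr /mrestr.
  apply: (@le_trans _ _ (lebesgue_stieltjes_measure M A)).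
    by apply: le_measure; rewrite ?inE//; exact: measurableI.
  apply: (le_trans (@lebesgue_stieltjes_le _ M _ c0 _ A)).
    by move=> s t /mc/andP[].
  by rewrite A0 mule0.
exists (fine \o g).
have fg : EFin \o (fine \o g) = g by apply/funext => x /=; rewrite fineK.
split; first by rewrite fg.
  by move=> x; apply: fine_ge0.
move=> x /andP[ax xb].
transitivity (\int[lebesgue_measure]_(t in `]a, x]) g t)%E.
  by apply: eq_integral => t _; rewrite fineK.
rewrite -gE; last exact: measurable_itv.
rewrite /= /mfrestr /mrestr setIidl; first exact: Mab.
by move=> t /=; rewrite !in_itv/= => /andP[-> /le_trans]; exact.
Qed.

(** * Measurability in the plane *)

Lemma open_measurable_prod (R : realType) (U : set (R * R)) :
  open U -> measurable U.
Proof.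
move=> oU.
(* An open set is the union of the rational rectangles that it contains; the others are replaced by
   [set0] to keep a fixed countable index type. *)
pose I (q : rat * rat) : set R := `]ratr q.1, ratr q.2[%classic.
pose P (q : (rat * rat) * (rat * rat)) : set (R * R) := I q.1 `*` I q.2.
rewrite (_ : U = \bigcup_(q in setT) if `[< P q `<=` U >] then P q else set0).
  apply: countable_bigcupT_measurable => [|q]; first exact: countableP.
  by case: ifP => // _; apply: measurableX; exact: measurable_itv.
have nI (x : R) (A : set R) : nbhs x A -> exists2 q, I q x & I q `<=` A.
  move=> /nbhs_ballP[e /= e0 eA].
  have xe : x - e < x by rewrite ltrBlDr ltrDl.
  have ex : x < x + e by rewrite ltrDl.
  have [q1 /[!in_itv]/= /andP[q1a q1b]] := rat_in_itvoo xe.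
  have [q2 /[!in_itv]/= /andP[q2a q2b]] := rat_in_itvoo ex.
  exists (q1, q2); first by rewrite /I /= in_itv/= q1b q2a.
  move=> t; rewrite /I /= in_itv/= => /andP[t1 t2]; apply: eA.
  rewrite /ball/= ltr_distlC; apply/andP; split.
    exact: lt_trans t1.
  exact: lt_trans q2b.
apply/seteqP; split => [[x y] Uxy|p [q _]]; last by case: ifPn => // /asboolP; exact.
have /= [[A B] /= [/nI[q Ax qA] /nI[q' By q'B]] AB] := open_nbhs_nbhs (conj oU Uxy).
exists (q, q') => //; case: asboolP => //= -[]; move=> [s t] [/= s1 t1].
by apply: AB; split; [exact: qA|exact: q'B].
Qed.

Lemma closed_measurable_prod (R : realType) (U : set (R * R)) :
  closed U -> measurable U.
Proof.
move=> cU; rewrite -(setCK U); apply: measurableC; apply: open_measurable_prod.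
exact: closed_openC.
Qed.

Lemma continuous_measurable_prod (R : realType) (W : R * R -> R) :
  continuous W -> measurable_fun setT W.
Proof.
move=> cW; apply: (measurability _ (RGenOpens.measurableE R)).
move=> _ [_ [a [b ->] <-]]; rewrite setTI; apply: open_measurable_prod.
by move/continuousP : cW; apply; exact: interval_open.
Qed.

Section measurable_partial.
Variables (R : realType) (W : R * R -> R).
Hypothesis cW : continuous W.

Let quot (h : R) (p : R * R) := h^-1 * (W (h + p.1, p.2) - W p).

Let cquot h : continuous (quot h).
Proof.
move=> p; apply: cvgM; first exact: cvg_cst.
apply: cvgB; last exact: cW.
apply: (@continuous_comp _ _ _ (fun p : R * R => (h + p.1, p.2)) W); last exact: cW.
apply: (@cvg_pair _ _ _ _ (nbhs (h + p.1)) (nbhs p.2)).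
  by apply: cvgD; [exact: cvg_cst|exact: cvg_fst].
exact: cvg_snd.
Qed.

Let derivableE p : derivable (fun x => W (x, p.2)) p.1 1 = cvg (quot h p @[h --> 0^']).
Proof.
case: p => x y; rewrite /derivable /=.
suff -> : (fun h => quot h (x, y)) =
  fun h : R => h^-1 *: (((fun x => W (x, y)) \o shift x) (h *: 1) - W (x, y)) by [].
by apply/funext => h /=; rewrite [h *: 1]mulr1.
Qed.

Let C (j n : nat) : set (R * R) := [set p | forall h h',
   0 < `|h| < n.+1%:R^-1 -> 0 < `|h'| < n.+1%:R^-1 ->
   `|quot h p - quot h' p| <= j.+1%:R^-1].

(** By the Cauchy criterion, differentiability at [p] means that for each [j] some [C j n] contains
    [p]. Each [C j n] is closed, as an intersection, over all pairs of increments, of closed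
    conditions on [p]. *)
Lemma measurable_derivable_fst :
  measurable [set p : R * R | derivable (fun x => W (x, p.2)) p.1 1].
Proof.
rewrite (_ : [set _ | _] = \bigcap_j \bigcup_n C j n).
  apply: bigcap_measurable => // j _; apply: bigcup_measurable => n _.
  apply: closed_measurable_prod.
  rewrite (_ : C j n = \bigcap_(hh in [set hh : R * R |
    0 < `|hh.1| < n.+1%:R^-1 /\ 0 < `|hh.2| < n.+1%:R^-1])
    ((fun p => `|quot hh.1 p - quot hh.2 p|) @^-1` [set x | x <= j.+1%:R^-1])).
    apply: closed_bigI => -[h h'] _; apply: preimage_closed; last exact: closed_le.
    move=> p _; apply: cvg_norm; apply: cvgB; exact: cquot.
  apply/seteqP; split => [p Cp [h h'] /= [? ?]|p Cp h h' ? ?]; first exact: Cp.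
  exact: (Cp (h, h')).
apply/seteqP; split => [p /=|p Cp /=]; rewrite derivableE.
  move=> /cauchy_cvgP/cauchy_ballP cq j _.
  have j0 : (0 : R) < j.+1%:R^-1 by rewrite invr_gt0.
  have := cq _ j0; rewrite !near_simpl => HH.
  have [d /= d0 dH] : exists2 d : R, 0 < d & forall h h', 0 < `|h| < d -> 0 < `|h'| < d ->
      `|quot h p - quot h' p| < j.+1%:R^-1.
    case: HH => -[P Q] /= [/nbhs_ballP[d1 /= d10 d1P] /nbhs_ballP[d2 /= d20 d2Q]] PQ.
    have nz (h : R) : 0 < `|h| -> h != 0 by rewrite normr_gt0.
    exists (Num.min d1 d2); first by rewrite lt_min d10.
    move=> h h' /andP[h0 +] /andP[h'0 +]; rewrite !lt_min => /andP[h1 _] /andP[_ h2].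
    apply: (PQ (h, h')); split => /=.
      by apply: d1P; [rewrite /ball/= sub0r normrN|exact: nz].
    by apply: d2Q; [rewrite /ball/= sub0r normrN|exact: nz].
  have [n nd] := ltr_add_invr d0; rewrite add0r in nd.
  exists n => // h h' /andP[h0 hn] /andP[h'0 h'n]; apply/ltW/dH.
    by rewrite h0 (lt_trans hn).
  by rewrite h'0 (lt_trans h'n).
apply/cauchy_cvgP/cauchy_ballP => e e0.
have [j je] := ltr_add_invr e0; rewrite add0r in je.
have [n _ Cn] := Cp j I.
rewrite !near_simpl.
exists ([set h | 0 < `|h| < n.+1%:R^-1], [set h | 0 < `|h| < n.+1%:R^-1]) => /=.
  have nn : 0^' [set h : R | 0 < `|h| < n.+1%:R^-1].
    exists n.+1%:R^-1; first by rewrite /= invr_gt0.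
    by move=> h /=; rewrite sub0r normrN normr_gt0 => -> ->.
  by split.
by move=> [h h'] /= [hn h'n]; rewrite /ball/=; apply: le_lt_trans je; exact: Cn.
Qed.

Lemma measurable_derive_fst :
  measurable_fun setT (fun p : R * R => derive1 (fun x => W (x, p.2)) p.1).
Proof.
set S := [set p : R * R | derivable (fun x => W (x, p.2)) p.1 1].
have mS : measurable S by exact: measurable_derivable_fst.
rewrite -(setUv S); apply/measurable_funU => //; first exact: measurableC.
(* Off [S] the quotients diverge and [derive1] takes the default value 0. *)
split; last first.
  apply: (@eq_measurable_fun _ _ (R * R)%type R (~` S) (cst 0)); last exact: measurable_cst.
  move=> p; rewrite inE => Sp. by rewrite derive1E /derive dvgP.
apply: (measurable_fun_cvg (h := fun n => quot n.+1%:R^-1)).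
  move=> n; apply: measurable_funTS; apply: continuous_measurable_prod; exact: cquot.
move=> p; rewrite /S /= derivableE => Sp.
rewrite derive1E /derive.
have -> : (fun h : R => h^-1 *: (((fun x => W (x, p.2)) \o shift p.1) (h *: 1) -
    W (p.1, p.2))) = (fun h => quot h p).
  by case: (p) => x y; apply/funext => h /=; rewrite [h *: 1]mulr1.
apply: cvg_trans Sp.
move=> A [d /= d0 dA].
have [n nd] := ltr_add_invr d0; rewrite add0r in nd.
exists n => // k /= nk; apply: dA; last by rewrite gt_eqF// invr_gt0.
rewrite /= sub0r normrN gtr0_norm ?invr_gt0//; apply: le_lt_trans nd.
by rewrite lef_pV2 ?posrE// ler_nat.
Qed.

End measurable_partial.

Lemma measurable_derive1 (R : realType) (h : R -> R) :
  continuous h -> measurable_fun setT (derive1 h).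
Proof.
move=> ch.
have cW : continuous (h \o fst : R * R -> R).
  by move=> p; apply: (continuous_comp (f := fst)); [exact: cvg_fst|exact: ch].
have mp : measurable_fun setT (fun x : R => (x, 0 : R)) by exact: measurable_fun_pair.
exact: (measurableT_comp (measurable_derive_fst cW) mp).
Qed.

Lemma measurable_derive_snd (R : realType) (W : R * R -> R) :
  continuous W ->
  measurable_fun setT (fun p : R * R => derive1 (fun y => W (p.1, y)) p.2).
Proof.
move=> cW.
have cWs : continuous (W \o (fun p : R * R => (p.2, p.1))).
  move=> p; apply: continuous_comp; last exact: cW.
  by apply: (@cvg_pair _ _ _ _ (nbhs p.2) (nbhs p.1)); [exact: cvg_snd|exact: cvg_fst].
have mp : measurable_fun setT (fun p : R * R => (p.2, p.1)) by exact: measurable_fun_pair.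
exact: (measurableT_comp (measurable_derive_fst cWs) mp).
Qed.

(** * Comparison of integrals up to null sets *)

Import HBNNSimple.

(* No measurability is needed: the integral of a nonnegative function is the
   supremum of the integrals of the simple functions below it. *)
Lemma ge0_le_integralZl_ae d (T : measurableType d) (R : realType)
    (mu : {measure set T -> \bar R}) (D E N : set T) (L : R) (f g : T -> \bar R) :
  0 < L -> (forall x, D x -> 0 <= f x)%E -> (forall x, E x -> 0 <= g x)%E ->
  mu.-negligible N ->
  (forall x, D x -> ~ N x -> E x /\ (f x <= L%:E * g x)%E) ->
  (\int[mu]_(x in D) f x <= L%:E * \int[mu]_(x in E) g x)%E.
Proof.
move=> L0 f0 g0 [M [mM M0 NM]] fg.
rewrite [leLHS]integral_mkcond [X in (_ * X)%E]integral_mkcond.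
rewrite ge0_integralTE => [|x]; last exact: erestrict_ge0.
apply: ge_ereal_sup => _ [h hf <-].
have mMc : measurable (~` M) by exact: measurableC.
have Lv0 : 0 <= L^-1 by rewrite invr_ge0 ltW.
(* Divided by [L] and set to 0 on the null set [M], a simple function below [f] on [D] becomes one
   below [g] on [E]. *)
pose k := scale_nnsfun (mul_nnsfun h (indic_nnsfun R mMc)) Lv0.
have kE x : k x = L^-1 * (h x * \1_(~` M) x) by [].
apply: (@le_trans _ _ (L%:E * \int[mu]_x (k x)%:E)%E); last first.
  rewrite lee_pmul2l// [leRHS]ge0_integralTE => [|x]; last exact: erestrict_ge0.
  rewrite integralT_nnsfun; apply: ereal_sup_ubound; exists k => // x.
  rewrite kE indicE; have [Mx|Mx] := boolP (x \in ~` M); last first.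
    by rewrite !mulr0; exact: erestrict_ge0.
  rewrite mulr1; have := hf x; rewrite !patchE; case: ifPn => [xD hx|xD hx].
    have [Ex fgx] := fg x (set_mem xD) (fun n => set_mem Mx (NM _ n)).
    rewrite mem_set// EFinM lee_pdivrMl//; exact: le_trans fgx.
  have -> : h x = 0 by apply/eqP; rewrite eq_le -lee_fin hx/=.
  by rewrite mulr0; case: ifPn => // /set_mem; exact: g0.
rewrite -integralT_nnsfun -ge0_integralZl//; last 3 first.
- by apply/measurable_EFinP.
- by move=> x _; rewrite lee_fin.
- by rewrite lee_fin ltW.
rewrite le_eqVlt; apply/orP; left; apply/eqP; apply: ge0_ae_eq_integral => //.
- exact/measurable_EFinP.
- by apply/measurable_EFinP; exact: measurable_funM.
- by move=> x _; rewrite lee_fin.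
- by move=> x _; rewrite -EFinM lee_fin mulr_ge0// ltW.
exists M; split => // x /= /not_implyP[_ ne]; apply/not_notP => Mx; apply: ne.
by rewrite -[mindic _ _ _]/(\1_(~` M) x) indicE mem_set// mulr1 -EFinM mulrA divff ?gt_eqF// mul1r.
Qed.

Lemma ge0_le_integral_ae d (T : measurableType d) (R : realType)
    (mu : {measure set T -> \bar R}) (D E N : set T) (f g : T -> \bar R) :
  (forall x, D x -> 0 <= f x)%E -> (forall x, E x -> 0 <= g x)%E ->
  mu.-negligible N ->
  (forall x, D x -> ~ N x -> E x /\ (f x <= g x)%E) ->
  (\int[mu]_(x in D) f x <= \int[mu]_(x in E) g x)%E.
Proof.
move=> f0 g0 N0 fg; rewrite -[leRHS]mul1e.
by apply: (ge0_le_integralZl_ae _ f0 g0 N0) => // x Dx Nx; rewrite mul1e; exact: fg.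
Qed.

Lemma ge0_integral_subset d (T : measurableType d) (R : realType)
    (mu : {measure set T -> \bar R}) (D E : set T) (f g : T -> \bar R) :
  (forall x, D x -> 0 <= f x)%E -> (forall x, E x -> 0 <= g x)%E ->
  (forall x, D x -> E x /\ (f x <= g x)%E) ->
  (\int[mu]_(x in D) f x <= \int[mu]_(x in E) g x)%E.
Proof.
move=> f0 g0 fg; apply: (@ge0_le_integral_ae _ _ _ _ _ _ set0) => //.
  exact: negligible_set0.
by move=> x Dx _; exact: fg.
Qed.

(** * Differentiation of Lipschitz functions *)

Section lipschitz_calculus.
Variables (R : realType) (K : R) (h : R -> R).
Hypothesis hK : klip K h.
Local Notation mu := (@lebesgue_measure R).

(** Adding [K' * x] makes [h] nondecreasing, hence the integral of a density [g]. At a Lebesgue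
    point of [g] this integral has derivative [g t], so [h] has derivative [g t - K']; almost every
    point is one. *)
Let lipschitz_itv a b : a < b ->
  mu.-negligible [set t | a < t < b /\ ~ derivable h t 1] /\
  (`|h b - h a|%:E <= \int[mu]_(t in `]a, b]) `|derive1 h t|%:E)%E.
Proof.
move=> ab.
pose K' := `|K| + 1; have K'0 : 0 < K' by rewrite ltr_wpDl.
have hK' : klip K' h by apply: klipW hK; rewrite (le_trans (ler_norm K))// lerDl.
pose m x := h x + K' * x.
have mc s t : s <= t -> 0 <= m t - m s <= (2 * K') * (t - s).
  move=> st; have := hK' t s; rewrite (ger0_norm (_ : 0 <= t - s)) ?subr_ge0//.
  rewrite ler_norml /m => /andP[? ?]; apply/andP; split; lra.
have [|g [intg g0 gE]] := lipschitz_nondecreasing_density _ ab mc; first by rewrite mulr_gt0.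
have lg : locally_integrable setT g by apply: open_integrable_locally => //; exact: openT.
have [N [mN N0 Nlg]] := lebesgue_differentiation lg.
have key t : a < t < b -> lebesgue_pt g t -> derivable h t 1 /\ derive1 h t = g t - K'.
  move=> /andP[at_ tb] gt.
  have intgb : mu.-integrable `]a, b] (EFin \o g) by apply: integrableS intg.
  have at' : (BRight a < BRight t)%O by rewrite bnd_simp.
  have [dF F'] := FTC1_lebesgue_pt tb intgb at' gt.
  set F := (fun y : R => _) in dF F'.
  have hF : {near t, F =1 (fun x => h x + K' * x - m a)}.
    have : t \in `]a, b[%R by rewrite in_itv/= at_ tb.
    move=> /near_in_itvoo; apply: filterS => x; rewrite in_itv/= => /andP[ax xb].
    by rewrite /F /Rintegral gE ?(ltW ax) ?(ltW xb).
  have dhm : derivable (fun x => h x + K' * x - m a) t 1 by exact: near_eq_derivable hF dF.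
  have hE : h = (fun x => (h x + K' * x - m a) - (K' * x - m a)) by apply/funext => x; lra.
  have dm : is_derive t 1 (fun x : R => K' * x - m a) K'.
    by apply: is_derive_eq; rewrite ?scaler0 ?addr0 ?subr0 /GRing.scale/= ?mulr1 ?mulr0 ?addr0.
  split; first by rewrite hE; apply: derivableB.
  rewrite hE derive1E deriveB//; congr (_ - _); last exact: derive_val.
  by rewrite -(near_eq_derive _ hF) -derive1E F'.
have aeN : mu.-negligible [set t | a < t < b /\ ~ derivable h t 1].
  exists N; split => // t /= [tab nd]; apply: Nlg => /= gt; apply: nd.
  by have [] := key t tab gt.
split => //.
have mh' : measurable_fun setT (derive1 h).
  by apply: measurable_derive1; exact: klip_continuous hK.
have intgb : mu.-integrable `]a, b] (EFin \o g) by apply: integrableS intg.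
have intK : mu.-integrable `]a, b] (EFin \o (cst K')).
  apply/integrableP; split; first by apply/measurable_EFinP; exact: measurable_cst.
  rewrite [X in (X < _)%E](_ : _ = \int[mu]_(x in `]a, b]) cst `|K'|%:E x)%E//.
  rewrite integral_cst//= lebesgue_measure_itv/= lte_fin ab.
  by rewrite -EFinB -EFinM ltry.
have -> : (`|h b - h a|%:E = `|\int[mu]_(t in `]a, b]) (g t - K')%:E|)%E.
  under eq_integral do rewrite EFinB.
  rewrite integralB_EFin// gE ?lexx ?ltW// integral_cst//=.
  rewrite lebesgue_measure_itv/= lte_fin ab.
  rewrite (_ : (m b - m a)%:E - _ = (h b - h a)%:E)%E//.
  by rewrite -(EFinB b) -EFinM -EFinB /m; congr EFin; ring.
apply: (le_trans (le_abse_integral _ _ _)) => //.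
  apply/measurable_EFinP; apply: measurable_funTS; apply: measurable_funB => //.
  by apply/measurable_EFinP; have /integrableP[] := intg.
apply: (@ge0_le_integral_ae _ _ _ _ _ _ (N `|` [set b])) => //.
  apply: negligibleU; first by exists N; split.
  by exists [set b]; split => //; exact: lebesgue_measure_set1.
move=> t tab /not_orP[Nt tb]; split => //.
have gt : lebesgue_pt g t by apply/not_notP => gt; apply: Nt; exact: Nlg.
have tab' : a < t < b.
  by move: tab; rewrite /= in_itv/= => /andP[-> +]; rewrite le_eqVlt => /orP[/eqP //|//].
by have [_ ->] := key t tab' gt.
Qed.

Lemma klip_ae_derivable : mu.-negligible [set t | ~ derivable h t 1].
Proof.
pose F n := [set t | - n.+1%:R < t < n.+1%:R /\ ~ derivable h t 1].
have FN n : mu.-negligible (F n) by apply: (lipschitz_itv _).1; rewrite gtrN.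
apply: negligibleS (negligible_bigcup FN) => t /= nd.
exists (Num.bound t) => //; split => //.
rewrite -ltr_norml; apply: lt_trans (unstable.ltr_norm_bound (t : R)) _.
by rewrite ltr_nat.
Qed.

(** The form used for segments and curves: [u] is a gradient or a speed, compared with the
    derivative only at interior points of differentiability outside a null set. *)
Lemma klip_le_integral (a b : R) (N : set R) (u : R -> \bar R) : a <= b ->
  mu.-negligible N -> (forall t, a <= t <= b -> (0 <= u t)%E) ->
  (forall t, a < t < b -> ~ N t -> derivable h t 1 ->
     (`|derive1 h t|%:E <= u t)%E) ->
  (`|h b - h a|%:E <= \int[mu]_(t in `[a, b]) u t)%E.
Proof.
rewrite le_eqVlt => /predU1P[->|ab] N0 u0 hu.
  by rewrite subrr normr0; apply: integral_ge0.
apply: (le_trans (lipschitz_itv ab).2).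
pose M : set (measurableTypeR R) := N `|` [set t | ~ derivable h t 1] `|` [set b].
apply: (@ge0_le_integral_ae _ _ _ _ _ _ M).
- by move=> t _.
- by move=> t /=; rewrite in_itv/=; exact: u0.
- apply: negligibleU; first exact: negligibleU N0 klip_ae_derivable.
  by exists [set b]; split => //; exact: lebesgue_measure_set1.
move=> t /= tab /not_orP[/not_orP[Nt /contrapT dt] tb].
have tab' : a < t < b.
  by move: tab; rewrite in_itv/= => /andP[-> +]; rewrite le_eqVlt => /orP[/eqP //|//].
split; last exact: hu.
by move: tab' => /andP[? ?]; rewrite in_itv/= !ltW.
Qed.

End lipschitz_calculus.

(** * Lengths of curves *)

Lemma near_eq_derive1 (R : realType) (f g : R -> R) (t : R) :
  {near t, f =1 g} -> derive1 f t = derive1 g t.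
Proof. by move=> fg; rewrite !derive1E; exact: near_eq_derive. Qed.

Lemma derive1_cvg (R : realType) (f : R -> R) (t : R) : derivable f t 1 ->
  h^-1 * (f (h + t) - f t) @[h --> 0^'] --> derive1 f t.
Proof.
rewrite /derivable => df.
suff E : (fun h : R => h^-1 *: ((f \o shift t) (h *: 1) - f t)) =
    (fun h => h^-1 * (f (h + t) - f t)) by rewrite E in df.
by apply/funext => h /=; rewrite [h *: 1]mulr1.
Qed.

(** Pass to the limit in the difference quotients. It replaces the chain rule for truncations and
    cutoffs, which are Lipschitz but not differentiable everywhere. *)
Lemma le_norm_derive1 (R : realType) (X Y Z : R -> R) (a b t : R) :
  derivable X t 1 -> derivable Y t 1 -> derivable Z t 1 ->
  (\forall s \near t, `|Z s - Z t| <= a * `|X s - X t| + b * `|Y s - Y t|) ->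
  `|derive1 Z t| <= a * `|derive1 X t| + b * `|derive1 Y t|.
Proof.
move=> dX dY dZ H.
have cnorm (c : R) (h : R -> R) : derivable h t 1 ->
    c * `|x^-1 * (h (x + t) - h t)| @[x --> 0^'] --> c * `|derive1 h t|.
  by move=> dh; apply: cvgM; [exact: cvg_cst|apply: cvg_norm; exact: derive1_cvg].
have cZ : `|x^-1 * (Z (x + t) - Z t)| @[x --> 0^'] --> `|derive1 Z t|.
  by apply: cvg_norm; exact: derive1_cvg.
apply: (ler_cvg_to cZ (cvgD (cnorm a X dX) (cnorm b Y dY))).
have [d /= d0 dH] := H.
exists d => //= h /=; rewrite sub0r normrN => hd h0.
rewrite [leRHS](_ : _ = `|h^-1| * (a * `|X (h + t) - X t| + b * `|Y (h + t) - Y t|)); last first.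
  by rewrite -[LHS]/(a * `|h^-1 * (X (h + t) - X t)| + b * `|h^-1 * (Y (h + t) - Y t)|) !normrM; ring.
rewrite normrM ler_wpM2l//.
by apply: dH; rewrite /= opprD addrCA subrr addr0 normrN.
Qed.

Section curves.
Variable R : realType.
Local Notation mu := (@lebesgue_measure R).
Implicit Types (f X Y Z V : R -> R).

Definition graph_length f X Y : \bar R :=
  (\int[mu]_(t in `[0%R, 1%R]) arc_speed f (X t) (derive1 X t, derive1 Y t))%E.

Lemma arc_speed_ge0 f x v : (0 <= arc_speed f x v)%E.
Proof. by rewrite /arc_speed; case: ifP => // _; rewrite lee_fin sqrtr_ge0. Qed.

Lemma le_norm_arc_speed f x v : (`|v.1|%:E <= arc_speed f x v)%E.
Proof.
rewrite /arc_speed; case: ifP => _; first by rewrite leey.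
by rewrite lee_fin -sqrtr_sqr ler_wsqrtr// lerDl sqr_ge0.
Qed.

(** Where [f x = 0], the right side is infinite unless [v = 0], and then [v'] must vanish for the
    left side to be finite. The term in [b] allows a vertical displacement that depends on the
    abscissa. *)
Lemma arc_speed_le f x z (u v u' v' a b : R) : 0 < a -> 0 <= b ->
  `|u'| <= a * `|u| -> (f x = 0 -> v = 0 -> v' = 0) ->
  (f x != 0 -> f z != 0 /\ `|v' / f z| <= a * `|v / f x| + b * `|u|) ->
  (arc_speed f z (u', v') <= (a + b)%:E * arc_speed f x (u, v))%E.
Proof.
move=> a0 b0 uu fx0 fx1.
have ab0 : 0 < a + b by rewrite ltr_pwDl.
(* The vector [(a u, a w + b u)] is [a] times [(u, w)] plus [b] times [(0, u)], so its norm is at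
   most [a + b] times that of [(u, w)]. *)
have S (w w' : R) : `|w'| <= a * `|w| + b * `|u| ->
    Num.sqrt (u' ^+ 2 + w' ^+ 2) <= (a + b) * Num.sqrt (u ^+ 2 + w ^+ 2).
  move=> ww; rewrite -[X in X * Num.sqrt _]ger0_norm ?(ltW ab0)// -sqrtr_sqr -sqrtrM ?sqr_ge0//.
  rewrite ler_wsqrtr//.
  have h1 : u' ^+ 2 <= (a * `|u|) ^+ 2.
    by rewrite -real_normK ?num_real// ler_sqr ?nnegrE// mulr_ge0// ltW.
  have h2 : w' ^+ 2 <= (a * `|w| + b * `|u|) ^+ 2.
    rewrite -real_normK ?num_real// ler_sqr ?nnegrE//.
    by rewrite addr_ge0// mulr_ge0// ltW.
  rewrite -(real_normK (num_real u)) -(real_normK (num_real w)).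
  have n1 : 0 <= `|u| by []. have n2 : 0 <= `|w| by [].
  have n3 := sqr_ge0 (`|u| - `|w|).
  move: h1 h2 n1 n2 n3 ab0; set U := `|u|; set W := `|w| => h1 h2 n1 n2 n3 ab0.
  have ab1 : 0 <= a * b by rewrite mulr_ge0// ltW.
  have := mulr_ge0 ab1 n3.
  have := mulr_ge0 (ltW a0) (mulr_ge0 b0 (sqr_ge0 W)).
  have := mulr_ge0 (ltW a0) (mulr_ge0 b0 (sqr_ge0 U)).
  have := sqr_ge0 (b * W).
  nra.
rewrite /arc_speed /=; have [fx|fx] := eqVneq (f x) 0.
  have [v0|v0] := eqVneq v 0; last by rewrite /= gt0_muley ?leey// lte_fin.
  rewrite (fx0 fx v0) eqxx andbF /= -EFinM lee_fin v0 !mul0r; apply: S.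
  by rewrite normr0 mulr0 add0r mulr_ge0.
have [fz vv] := fx1 fx.
by rewrite (negbTE fz)/= -EFinM lee_fin; exact: S.
Qed.

Lemma graph_length_le f X Y Z V (K c : R) (N : set R) : 0 < c ->
  klip K X -> klip K Y -> klip K Z -> klip K V -> mu.-negligible N ->
  (forall t, 0 < t < 1 -> ~ N t ->
    derivable X t 1 -> derivable Y t 1 -> derivable Z t 1 -> derivable V t 1 ->
    (arc_speed f (Z t) (derive1 Z t, derive1 V t) <=
     c%:E * arc_speed f (X t) (derive1 X t, derive1 Y t))%E) ->
  (graph_length f Z V <= c%:E * graph_length f X Y)%E.
Proof.
move=> c0 kX kY kZ kV N0 H.
pose D (h : R -> R) : set (measurableTypeR R) := [set t | ~ derivable h t 1].
pose M : set (measurableTypeR R) := N `|` D X `|` D Y `|` D Z `|` D V `|` [set 0] `|` [set 1].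
have D0 h : klip K h -> mu.-negligible (D h) by exact: klip_ae_derivable.
have s0 (x : R) : mu.-negligible ([set x] : set (measurableTypeR R)).
  by exists [set x]; split => //; exact: lebesgue_measure_set1.
apply: (@ge0_le_integralZl_ae _ _ _ _ _ _ M) => //.
- by move=> x _; exact: arc_speed_ge0.
- by move=> x _; exact: arc_speed_ge0.
- apply: negligibleU (s0 1); apply: negligibleU (s0 0).
  apply: negligibleU (D0 _ kV); apply: negligibleU (D0 _ kZ).
  by apply: negligibleU (D0 _ kY); exact: negligibleU (D0 _ kX).
move=> t tD /not_orP[/not_orP[/not_orP[/not_orP[/not_orP[/not_orP[tN tX] tY] tZ] tV] t0] t1].
split => //; apply: (H t _ tN (contrapT tX) (contrapT tY) (contrapT tZ) (contrapT tV)).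
move: tD; rewrite /= in_itv/= => /andP[t0' t1']; rewrite !lt_neqAle t0' t1' !andbT.
by apply/andP; split; apply/eqP => e; [apply: t0|apply: t1].
Qed.

End curves.

(** * Curves from the origin to a point of the half ball *)

Section paths.
Variable R : realType.
Local Notation mu := (@lebesgue_measure R).
Implicit Types (f X Y Z V : R -> R).

(** A normalised witness of membership in the half ball: coordinates Lipschitz on the whole line,
    and a curve kept in the closed right half plane. *)
Definition half_path f r x y X Y :=
  [/\ exists K, [/\ klip K X, klip K Y & forall t, `|Y t| <= K],
      [/\ X 0 = 0, Y 0 = 0, X 1 = x & Y 1 = y],
      forall t, 0 <= X t < r & (graph_length f X Y < r%:E)%E].

Lemma graph_length_ge f X Y K t : klip K X -> klip K Y -> 0 <= t <= 1 ->
  (`|X t - X 0|%:E <= graph_length f X Y)%E.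
Proof.
move=> kX kY /andP[t0 t1].
apply: (le_trans (@klip_le_integral _ _ _ kX 0 t set0
  (fun t => arc_speed f (X t) (derive1 X t, derive1 Y t)) t0 _ _ _)).
- exact: negligible_set0.
- by move=> s _; exact: arc_speed_ge0.
- by move=> s _ _ _; exact: le_norm_arc_speed.
- apply: ge0_integral_subset => [s _|s _|s /=]; [exact: arc_speed_ge0..|].
  by rewrite !in_itv/= => /andP[-> st]; split => //; exact: le_trans t1.
Qed.

Lemma half_ball_intro f r X Y K : klip K X -> klip K Y -> X 0 = 0 -> Y 0 = 0 ->
  0 < X 1 -> (graph_length f X Y < r%:E)%E -> half_ball f r (X 1, Y 1).
Proof.
move=> kX kY X0 Y0 X1 lr; split => //=; rewrite /control_ball /=.
apply: le_lt_trans lr; apply: ereal_inf_lbound.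
exists (fun t => (X t, Y t)) => //; split => //; last by rewrite X0 Y0.
apply: (@klipschitzW _ _ _ K).
  by apply: (@globally_properfilter _ _ (0, 0)); split; rewrite /= in_itv/= lexx ler01.
move=> [s t] _ /=; rewrite prod_normE /= ge_max.
by rewrite kX kY.
Qed.

(** The retraction of the line onto [[0, 1]]. It extends curves beyond [[0, 1]], and later serves as
    a piecewise affine building block and as a cutoff. *)
Definition unit_clamp (t : R) : R := Num.max 0 (Num.min 1 t).

Lemma unit_clamp_itv t : 0 <= unit_clamp t <= 1.
Proof.
by rewrite /unit_clamp le_max lexx/= ge_max ler01 ge_min lexx.
Qed.

Lemma unit_clamp_id t : 0 <= t <= 1 -> unit_clamp t = t.
Proof.
by move=> /andP[t0 t1]; rewrite /unit_clamp min_r// max_r.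
Qed.

Lemma klip_unit_clamp : klip 1 unit_clamp.
Proof.
move=> s t; rewrite mul1r /unit_clamp !(maxC 0) !(minC 1).
exact: le_trans (ler_dist_max _ _ _) (ler_dist_min _ _ _).
Qed.

Lemma klip_comp_clamp K X : (forall s t, 0 <= s <= 1 -> 0 <= t <= 1 ->
  `|X s - X t| <= K * `|s - t|) -> 0 <= K -> klip K (X \o unit_clamp).
Proof.
move=> kX K0 s t /=; apply: (le_trans (kX _ _ (unit_clamp_itv s) (unit_clamp_itv t))).
by rewrite ler_wpM2l// (le_trans (klip_unit_clamp _ _))// mul1r.
Qed.

Lemma klip_norm K X : klip K X -> klip K (fun t => `|X t|).
Proof. by move=> kX s t; apply: le_trans (kX s t); exact: ler_dist_dist. Qed.

(** Reflecting the curve to [|X|] keeps its length, because [f] is even and the absolute value does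
    not increase increments. The abscissa stays below [r] because it is bounded by the length. *)
Lemma half_ball_path f r x y : (forall x, f (- x) = f x) -> 0 < r ->
  half_ball f r (x, y) -> 0 < x /\ exists X Y, half_path f r x y X Y.
Proof.
move=> fE r0 [/= + x0]; rewrite /control_ball /= => /ereal_inf_lt[_ [g [lg g0 g1] <-] gr].
split => //.
have [M M0 gM] := pinfty_ex_gt0 lg.
have gM' s t : 0 <= s <= 1 -> 0 <= t <= 1 -> `|g s - g t| <= M * `|s - t|.
  by move=> s01 t01; apply: (gM (s, t)); split; rewrite /= in_itv.
pose X := (fun t => (g t).1) \o unit_clamp; pose Y := (fun t => (g t).2) \o unit_clamp.
have kX : klip M X.
  apply: klip_comp_clamp; last exact: ltW.
  by move=> s t s01 t01; apply: le_trans (gM' _ _ s01 t01); rewrite prod_normE le_max lexx.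
have kY : klip M Y.
  apply: klip_comp_clamp; last exact: ltW.
  by move=> s t s01 t01; apply: le_trans (gM' _ _ s01 t01); rewrite prod_normE le_max lexx orbT.
have kA : klip M (fun t => `|X t|) by exact: klip_norm.
have c0 : unit_clamp 0 = 0 by rewrite unit_clamp_id// lexx ler01.
have c1 : unit_clamp 1 = 1 by rewrite unit_clamp_id// lexx ler01.
have lXY : (graph_length f X Y < r%:E)%E.
  apply: le_lt_trans gr.
  apply: (@ge0_le_integral_ae _ _ _ _ _ _ ([set 0] `|` [set 1] : set (measurableTypeR R))).
  - by move=> t _; exact: arc_speed_ge0.
  - by move=> t _; exact: arc_speed_ge0.
  - apply: negligibleU.
      by exists [set 0]; split => //; exact: lebesgue_measure_set1.
    by exists [set 1]; split => //; exact: lebesgue_measure_set1.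
  move=> t /= t01 /not_orP[t0 t1]; split => //.
  have t01' : t \in `]0, 1[%R.
    move: t01; rewrite !in_itv/= => /andP[t0' t1']; rewrite !lt_neqAle t0' t1' !andbT.
    by apply/andP; split; apply/eqP => e; [apply: t0|apply: t1].
  have near01 (h : R -> R) : derive1 (h \o unit_clamp) t = derive1 h t.
    apply: near_eq_derive1; have := near_in_itvoo t01'; apply: filterS => s.
    by rewrite in_itv/= => /andP[s0 s1]; rewrite /= unit_clamp_id// !ltW.
  by rewrite /X /Y !near01 /= unit_clamp_id.
exists (fun t => `|X t|), Y; split.
- exists M; split => // t; have /andP[t0 t1] := unit_clamp_itv t.
  have := gM' _ _ (unit_clamp_itv t) (_ : 0 <= 0 <= 1); rewrite lexx ler01 => /(_ isT).
  rewrite g0 !subr0 prod_normE ge_max => /andP[_ /le_trans]; apply.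
  by rewrite ger0_norm// ler_piMr// ltW.
- by rewrite /X /Y /= c0 c1 g0 g1 /= normr0 gtr0_norm.
- move=> t; rewrite normr_ge0/=.
  have -> : X t = X (unit_clamp t) by rewrite /X /= [in RHS]unit_clamp_id// unit_clamp_itv.
  rewrite -lte_fin; apply: le_lt_trans lXY.
  have := @graph_length_ge f X Y M (unit_clamp t) kX kY (unit_clamp_itv t).
  by rewrite {2}/X /= c0 g0 subr0.
- apply: le_lt_trans lXY; rewrite -[leRHS]mul1e.
  apply: (@graph_length_le _ _ _ _ _ _ M 1 set0) => //; first exact: negligible_set0.
  move=> t t01 _ dX dY dA _; rewrite -[1%R in leRHS]addr0.
  have fn : f `|X t| = f (X t) by case: (ger0P (X t)).
  apply: arc_speed_le => //.
    rewrite mul1r -[leRHS]addr0 -[X in _ + X](mul0r `|derive1 Y t|).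
    rewrite -[X in X + _]mul1r; apply: le_norm_derive1 => //.
    by apply: (@filterE _ (nbhs t)) => s; rewrite mul0r addr0 mul1r; exact: ler_dist_dist.
  by rewrite fn => fx; split; rewrite // mul1r mul0r addr0.
Qed.

End paths.

(** * A Poincaré inequality for planar domains *)

Section average.
Variables (R : realType).

(** By uniqueness of Lebesgue measure, it equals [1 / c] times its image under [y / c], as half-open
    intervals show. *)
Lemma ge0_integral_dilation (c : R) (g : R -> \bar R) : 0 < c ->
  measurable_fun setT g -> (forall y, 0 <= g y)%E ->
  (\int[lebesgue_measure]_y g (y / c)%R = c%:E * \int[lebesgue_measure]_y g y)%E.
Proof.
move=> c0 mg g0.
have md : measurable_fun setT (fun y : measurableTypeR R => y / c : measurableTypeR R).
  by apply: continuous_measurable_fun => y; apply: cvgM; [exact: cvg_id|exact: cvg_cst].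
have cV0 : 0 <= c^-1 by rewrite invr_ge0 ltW.
pose m : {measure set (measurableTypeR R) -> \bar R} :=
  mscale (NngNum cV0) (pushforward lebesgue_measure (fun y : measurableTypeR R => y / c : measurableTypeR R)).
have mE (A : set (measurableTypeR R)) : measurable A -> lebesgue_measure A = m md A.
  apply: lebesgue_measure_unique => _ [[a b] _ <-] /=.
  rewrite /mscale /=.
  rewrite (_ : pushforward _ _ _ = lebesgue_measure (`]a * c, b * c]%classic : set R)); last first.
    rewrite /pushforward; congr (lebesgue_measure _).
    by apply/seteqP; split => y /=; rewrite !in_itv/= ltr_pdivlMr// ler_pdivrMr.
  rewrite !lebesgue_measure_itv/= !lte_fin ltr_pM2r//.
  case: ifP => ab; last by rewrite mule0.
  by rewrite -!EFinB -EFinM; congr EFin; field; rewrite gt_eqF.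
rewrite [X in (_ * X)%E](eq_measure_integral (m md)) => [|A mA _]; last exact: mE.
rewrite ge0_integral_mscale//= ge0_integral_pushforward//=.
by rewrite muleA -EFinM mulfV ?gt_eqF// mul1e.
Qed.

(** The average is at distance at most the mean of [|w - c|] from [c], so trading [c] for it at most
    doubles the integral. *)
Lemma integral_dist_average d (T : measurableType d) (mu : {measure set T -> \bar R})
    (D : set T) (w : T -> R) (c : R) :
  measurable D -> (0 < mu D)%E -> (mu D < +oo)%E -> mu.-integrable D (EFin \o w) ->
  (\int[mu]_(x in D) `|w x - (fine (mu D))^-1 * \int[mu]_(x in D) w x|%:E <=
   2%:E * \int[mu]_(x in D) `|w x - c|%:E)%E.
Proof.
move=> mD D0 Doo iw.
have Dfin : mu D \is a fin_num by rewrite ge0_fin_numE// ltW.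
set M := fine (mu D); have M0 : 0 < M by rewrite fine_gt0// D0.
have ic (a : R) : mu.-integrable D (EFin \o cst a).
  by apply: measurable_bounded_integrable => //; exact: bounded_cst.
have iwc (a : R) : mu.-integrable D (fun x => (`|w x - a|)%:E).
  exact: (integrable_abse (integrableB mD iw (ic a))).
set A := M^-1 * _.
apply: (@le_trans _ _ (\int[mu]_(x in D) (`|w x - c|%:E + `|c - A|%:E))%E).
  apply: ge0_le_integral => //.
  - by have /integrableP[] := iwc A.
  - by apply: emeasurable_funD; [have /integrableP[] := iwc c|exact: measurable_cst].
  - move=> x _; rewrite -EFinD lee_fin (_ : w x - A = (w x - c) + (c - A)) ?ler_normD//; ring.
rewrite ge0_integralD//; last by have /integrableP[] := iwc c.
rewrite integral_cst//= -(fineK Dfin) -/M.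
rewrite (_ : 2%:E = 1%:E + 1%:E)%E// ge0_muleDl// mul1e leeD2l//.
have cA : c - A = - (M^-1 * \int[mu]_(x in D) (w x - c)).
  have -> : \int[mu]_(x in D) (w x - c) = \int[mu]_(x in D) w x - c * M.
    rewrite (@RintegralB _ _ _ mu D w (cst c) mD iw (ic c)).
    by congr (_ - _); exact: Rintegral_cst.
  by rewrite /A; field; rewrite gt_eqF.
rewrite cA normrN normrM gtr0_norm ?invr_gt0// -EFinM mulrAC mulVf ?gt_eqF// mul1r.
rewrite -[leRHS]fineK; last first.
  by apply: integrable_fin_num.
rewrite lee_fin; apply: le_normr_Rintegral => //.
exact: (integrableB mD iw (ic c)).
Qed.

End average.

(** McShane's formula. A function Lipschitz on the half ball only has to become Lipschitz along
    whole lines before the one-dimensional results apply. *)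
Lemma lipschitz_extension (R : realType) (D : set (R * R)) (w : R * R -> R) (M : R) :
  0 <= M -> (forall p q, D p -> D q -> `|w p - w q| <= M * `|p - q|) ->
  exists W : R * R -> R, (forall p q, `|W p - W q| <= M * `|p - q|) /\
    {in D, W =1 w}.
Proof.
move=> M0 wM; have [->|/set0P[d Dd]] := eqVneq D set0.
  by exists (cst 0); split => [p q|p /[!inE]//]; rewrite subrr normr0 mulr_ge0.
pose S p := [set w q + M * `|p - q| | q in D].
have tri (p p' q : R * R) : M * `|p - q| <= M * `|p' - q| + M * `|p - p'|.
  by rewrite -mulrDr ler_wpM2l// [leRHS]addrC; exact: ler_distD.
have lb p : has_lbound (S p).
  exists (w d - M * `|d - p|) => _ [q Dq <-].
  have := wM _ _ Dd Dq; rewrite ler_norml => /andP[_ h].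
  have := tri d p q; rewrite [`|d - p|]distrC => h2. lra.
have S0 p : S p !=set0 by exists (w d + M * `|p - d|); exists d.
have WM p p' : inf (S p) - inf (S p') <= M * `|p - p'|.
  rewrite lerBlDr -lerBlDl; apply: lb_le_inf => // _ [q Dq <-].
  rewrite lerBlDl; apply: (@le_trans _ _ (w q + M * `|p - q|)).
    by apply: ge_inf => //; exists q.
  have := tri p p' q; lra.
exists (fun p => inf (S p)); split => [p q|p].
  rewrite ler_norml WM andbT lerNl opprB distrC; exact: WM.
rewrite inE => Dp; apply/eqP; rewrite eq_le; apply/andP; split.
  by apply: ge_inf => //; exists p => //; rewrite subrr normr0 mulr0 addr0.
apply: lb_le_inf => // _ [q Dq <-].
by have := wM _ _ Dp Dq; rewrite ler_norml => /andP[_]; lra.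
Qed.

Lemma lebesgue2_tonelli_fst (R : realType) (G : R * R -> \bar R) :
  measurable_fun setT G -> (forall p, 0 <= G p)%E ->
  (\int[lebesgue2 R]_p G p =
   \int[lebesgue_measure]_x \int[lebesgue_measure]_y G (x, y))%E.
Proof.
move=> mG G0; exact: (@fubini_tonelli1 _ _ (measurableTypeR R) (measurableTypeR R) R
  lebesgue_measure lebesgue_measure G).
Qed.

Lemma lebesgue2_tonelli_snd (R : realType) (G : R * R -> \bar R) :
  measurable_fun setT G -> (forall p, 0 <= G p)%E ->
  (\int[lebesgue2 R]_p G p =
   \int[lebesgue_measure]_y \int[lebesgue_measure]_x G (x, y))%E.
Proof.
move=> mG G0; exact: (@fubini_tonelli2 _ _ (measurableTypeR R) (measurableTypeR R) R
  lebesgue_measure lebesgue_measure G).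
Qed.

Lemma integral_prod_mul (R : realType) (phi psi : R -> \bar R) :
  measurable_fun setT phi -> measurable_fun setT psi ->
  (forall x, 0 <= phi x)%E -> (forall x, 0 <= psi x)%E ->
  (\int[lebesgue2 R]_p (phi p.1 * psi p.2) =
   (\int[lebesgue_measure]_x phi x) * \int[lebesgue_measure]_y psi y)%E.
Proof.
move=> mphi mpsi phi0 psi0.
rewrite lebesgue2_tonelli_fst; last 2 first.
- apply: emeasurable_funM.
    exact: (measurableT_comp mphi measurable_fst).
  exact: (measurableT_comp mpsi measurable_snd).
- by move=> p; rewrite mule_ge0.
rewrite /= -ge0_integralZr//; last by apply: integral_ge0.
by apply: eq_integral => x _; rewrite ge0_integralZl.
Qed.

Lemma integral_indic_itvcc (R : realType) (a b : R) : a <= b ->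
  (\int[lebesgue_measure]_x (EFin \o \1_(`[a, b]%classic : set R)) x = (b - a)%:E)%E.
Proof.
move=> ab; rewrite integral_indic// setIT.
transitivity (lebesgue_measure (`[a, b]%classic : set R)) => //.
rewrite lebesgue_measure_itv/= lte_fin; case: ltP => [_|ba]; first by rewrite -EFinB.
by congr EFin; lra.
Qed.

(** Enlarge [Om] to the box [[0, r] x [- H, H]] and integrate each term by Tonelli: a function of
    [y] gains the width [r], a function of [x] the height [2 * H], and the dilation by [kap] a
    factor [kap]. *)
Lemma integral_le_box (R : realType) (Om : set (R * R)) (phi : R * R -> \bar R)
    (g v : R -> \bar R) (c : \bar R) (r H kap : R) :
  0 < r -> 0 <= H -> 0 < kap ->
  measurable_fun setT g -> measurable_fun setT v ->
  (forall y, 0 <= g y)%E -> (forall x, 0 <= v x)%E -> (0 <= c)%E ->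
  (forall p, Om p -> 0 <= phi p)%E ->
  (forall x y, Om (x, y) -> [/\ 0 <= x <= r, `|y| <= H &
     (phi (x, y) <= g y + g (y / kap)%R + (v x + c))%E]) ->
  (\int[lebesgue2 R]_(p in Om) phi p <=
   (r * (1 + kap))%:E * \int[lebesgue_measure]_y g y +
   (2 * H)%:E * \int[lebesgue_measure]_x v x + (2 * H * r)%:E * c)%E.
Proof.
move=> r_gt0 H_ge0 kap0 mg mv g_ge0 v_ge0 c_ge0 phi0 le_phi.
pose ix : R -> \bar R := EFin \o \1_(`[0, r]%classic : set R).
pose iy : R -> \bar R := EFin \o \1_(`[- H, H]%classic : set R).
have ix0 t : (0 <= ix t)%E by rewrite /ix /= lee_fin.
have iy0 t : (0 <= iy t)%E by rewrite /iy /= lee_fin.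
have mix : measurable_fun setT ix by apply/measurable_EFinP; exact: measurable_indic.
have miy : measurable_fun setT iy by apply/measurable_EFinP; exact: measurable_indic.
have intx : (\int[lebesgue_measure]_x ix x = r%:E)%E.
  by rewrite [LHS](integral_indic_itvcc (ltW r_gt0)) subr0.
have inty : (\int[lebesgue_measure]_x iy x = (2 * H)%:E)%E.
  have H1 : - H <= H by apply: (le_trans _ H_ge0); rewrite oppr_le0.
  rewrite [LHS](integral_indic_itvcc H1); congr EFin.
  by rewrite opprK mulr_natl mulr2n.
pose h y := (g y + g (y / kap)%R)%E.
have mgk : measurable_fun setT (fun y : R => g (y / kap)).
  apply: measurableT_comp => //; apply: continuous_measurable_fun => y.
  by apply: cvgM; [exact: cvg_id|exact: cvg_cst].
have h0 y : (0 <= h y)%E by rewrite adde_ge0.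
have mh : measurable_fun setT h by exact: emeasurable_funD.
pose T1 (p : R * R) := (ix p.1 * h p.2)%E.
pose T2 (p : R * R) := (v p.1 * iy p.2)%E.
pose T3 (p : R * R) := (ix p.1 * (c * iy p.2))%E.
have mT (k1 k2 : R -> \bar R) : measurable_fun setT k1 -> measurable_fun setT k2 ->
    measurable_fun setT (fun p : R * R => k1 p.1 * k2 p.2)%E.
  move=> m1 m2; apply: emeasurable_funM.
    exact: (measurableT_comp m1 measurable_fst).
  exact: (measurableT_comp m2 measurable_snd).
have mviy : measurable_fun setT (fun y => c * iy y)%E.
  by apply: emeasurable_funM => //; exact: measurable_cst.
have mT1 : measurable_fun setT T1 by exact: mT.
have mT2 : measurable_fun setT T2 by exact: mT.
have mT3 : measurable_fun setT T3 by exact: (mT ix (fun y => c * iy y)%E).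
have T10 p : (0 <= T1 p)%E by rewrite mule_ge0.
have T20 p : (0 <= T2 p)%E by rewrite mule_ge0.
have T30 p : (0 <= T3 p)%E by rewrite mule_ge0// mule_ge0.
apply: (@le_trans _ _ (\int[lebesgue2 R]_p (T1 p + T2 p + T3 p))%E).
  apply: ge0_integral_subset => [p Op|p _|[x y] O]; [exact: phi0|by rewrite !adde_ge0|].
  split => //; have [x01 yH phile] := le_phi x y O; apply: (le_trans phile).
  have ix1 : ix x = 1%E.
    by rewrite /ix /= indicE mem_set//= in_itv.
  have iy1 : iy y = 1%E.
    by rewrite /iy /= indicE mem_set//= in_itv/= -ler_norml; exact: yH.
  by rewrite /T1 /T2 /T3 /= ix1 iy1 !mul1e !mule1 addeA.
rewrite ge0_integralD//; last 2 first.
- by move=> p _; rewrite adde_ge0.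
- exact: emeasurable_funD.
rewrite ge0_integralD//.
have -> : (\int[lebesgue2 R]_p T1 p = (r * (1 + kap))%:E * \int[lebesgue_measure]_y g y)%E.
  rewrite (integral_prod_mul mix mh)// intx ge0_integralD// (ge0_integral_dilation kap0)//.
  rewrite EFinM -muleA EFinD ge0_muleDl ?lee_fin ?(ltW kap0)// mul1e//.
have -> : (\int[lebesgue2 R]_p T2 p = (2 * H)%:E * \int[lebesgue_measure]_x v x)%E.
  rewrite (integral_prod_mul mv miy)// inty muleC.
  by [].
have -> : (\int[lebesgue2 R]_p T3 p = (2 * H * r)%:E * c)%E.
  rewrite (integral_prod_mul mix mviy)//; last by move=> x; rewrite mule_ge0.
  by rewrite intx ge0_integralZl// inty [in RHS]EFinM [(c * _)%E]muleC muleA -EFinM -EFinM mulrC.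
by [].
Qed.

Section planar_poincare.
Variables (R : realType) (Om : set (R * R)) (r a' a kap H M : R).
Variable W : R * R -> R.
Local Notation mu := (@lebesgue_measure R).
Hypothesis oOm : open Om.
Hypothesis Om_x : forall x y, Om (x, y) -> 0 < x < r.
Hypothesis Om_y : forall x y, Om (x, y) -> `|y| <= H.
Hypothesis Om_scale : forall x y s, Om (x, y) -> `|s| <= 1 -> Om (x, s * y).
Hypothesis Om_right : forall x1 x y, Om (x1, y) -> x1 <= x -> x <= a -> Om (x, y).
Hypothesis Om_shrink : forall x x' y, Om (x, y) -> a' < x' -> x' <= x ->
  Om (x', kap^-1 * y).
Hypothesis a'_gt0 : 0 < a'.
Hypothesis a'a : a' < a.
Hypothesis ar : a < r.
Hypothesis kap_ge1 : 1 <= kap.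
Hypothesis H_ge0 : 0 <= H.
Hypothesis W_lip : forall p q, `|W p - W q| <= M * `|p - q|.

Let dx (p : R * R) : \bar R := `|derive1 (fun x => W (x, p.2)) p.1|%:E.
Let dy (p : R * R) : \bar R := `|derive1 (fun y => W (p.1, y)) p.2|%:E.
Let G1 := dx \_ Om.
(** Vertical segments occur only at abscissae beyond [a'], where [f >= m0] turns [|dW/dy|] into at
    most [|f dW/dy| / m0]; hence the smaller domain. *)
Let G2 := dy \_ (Om `&` [set p | a' < p.1]).
Let g y := (\int[mu]_x G1 (x, y))%E.
Let v x := (\int[mu]_y G2 (x, y))%E.

Let M0 : 0 <= M.
Proof.
have := le_trans (normr_ge0 _) (W_lip (1, 0) (0, 0)).
by rewrite prod_normE /= subr0 subrr normr1 normr0 max_l// mulr1.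
Qed.

Let cW : continuous W.
Proof.
move=> p; apply/cvgrPdist_le => /= e e0.
have K1 : 0 < M + 1 by rewrite ltr_wpDl.
exists (ball p.1 (e / (M + 1)), ball p.2 (e / (M + 1))) => /=.
  by split; apply: nbhsx_ballx; rewrite divr_gt0.
move=> q [/= q1 q2]; apply: (le_trans (W_lip p q)).
apply: (@le_trans _ _ ((M + 1) * `|p - q|)); first by rewrite ler_wpM2r// lerDl.
rewrite -ler_pdivlMl// [leRHS]mulrC prod_normE ge_max /=.
by apply/andP; split; exact: ltW.
Qed.

Let G1_ge0 p : (0 <= G1 p)%E.
Proof. by apply: erestrict_ge0 => q _; rewrite lee_fin. Qed.
Let G2_ge0 p : (0 <= G2 p)%E.
Proof. by apply: erestrict_ge0 => q _; rewrite lee_fin. Qed.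
Let g_ge0 y : (0 <= g y)%E. Proof. exact: integral_ge0. Qed.
Let v_ge0 x : (0 <= v x)%E. Proof. exact: integral_ge0. Qed.

Let mOm : measurable Om. Proof. exact: open_measurable_prod. Qed.

Let mG1 : measurable_fun setT G1.
Proof.
apply/(measurable_restrictT _ _).1 => //; apply: measurable_funTS.
by apply/measurable_EFinP; apply: measurableT_comp => //; exact: measurable_derive_fst.
Qed.

Let mG2 : measurable_fun setT G2.
Proof.
apply/(measurable_restrictT _ _).1.
  apply: measurableI => //; apply: open_measurable_prod.
  rewrite (_ : [set p : R * R | a' < p.1] = fst @^-1` [set x | a' < x])//.
  by apply: open_comp; [move=> p _; exact: cvg_fst|exact: open_gt].
apply: measurable_funTS; apply/measurable_EFinP; apply: measurableT_comp => //.
exact: measurable_derive_snd.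
Qed.

Let mg : measurable_fun setT g.
Proof.
exact: (@measurable_fun_fubini_tonelli_G _ _ (measurableTypeR R) (measurableTypeR R)
  R mu G1 mG1 G1_ge0).
Qed.

Let mv : measurable_fun setT v.
Proof.
exact: (@measurable_fun_fubini_tonelli_F _ _ (measurableTypeR R) (measurableTypeR R)
  R mu G2 mG2 G2_ge0).
Qed.

Let horizontal x x' y : x <= x' -> (forall t, x < t < x' -> Om (t, y)) ->
  (`|W (x', y) - W (x, y)|%:E <= g y)%E.
Proof.
move=> xx' O; have k : klip M (fun t => W (t, y)).
  move=> s t; apply: (le_trans (W_lip _ _)).
  by rewrite prod_normE /= subrr normr0 max_l.
apply: (le_trans (klip_le_integral k (N := set0) (u := fun t => G1 (t, y)) xx' _ _ _)).
- exact: negligible_set0.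
- by move=> t _.
- by move=> t tx _ _; rewrite /G1 patchE mem_set//; exact: O.
- by apply: ge0_integral_subset => // t _; split.
Qed.

Let vertical x y y' : a' < x -> y <= y' -> (forall t, y < t < y' -> Om (x, t)) ->
  (`|W (x, y') - W (x, y)|%:E <= v x)%E.
Proof.
move=> ax yy' O; have k : klip M (fun t => W (x, t)).
  move=> s t; apply: (le_trans (W_lip _ _)).
  by rewrite prod_normE /= subrr normr0 max_r.
apply: (le_trans (klip_le_integral k (N := set0) (u := fun t => G2 (x, t)) yy' _ _ _)).
- exact: negligible_set0.
- by move=> t _.
- by move=> t tx _ _; rewrite /G2 patchE mem_set//; split => //; exact: O.
- by apply: ge0_integral_subset => // t _; split.
Qed.

Let Om_between x y t : Om (x, y) -> `|t| <= `|y| -> Om (x, t).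
Proof.
move=> O ty; have [y0|y0] := eqVneq y 0.
  by move: ty; rewrite y0 normr0 normr_le0 => /eqP ->; rewrite -y0.
rewrite (_ : t = (t / y) * y); last by rewrite mulfVK.
by apply: Om_scale => //; rewrite normrM normfV ler_pdivrMr ?normr_gt0// mul1r.
Qed.

Let vertical_scale x y s : Om (x, y) -> a' < x -> 0 <= s <= 1 ->
  (`|W (x, y) - W (x, s * y)|%:E <= v x)%E.
Proof.
move=> O ax /andP[s0 s1]; have [y0|y0] := leP 0 y.
  apply: vertical => //; first by rewrite ler_piMl.
  move=> t /andP[t1 t2]; apply: Om_between O _.
  have t0 : 0 <= t by apply: le_trans (ltW t1); rewrite mulr_ge0.
  by rewrite (ger0_norm t0) (ger0_norm y0) ltW.
rewrite distrC; apply: vertical => //; first by nra.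
move=> t /andP[t1 t2]; apply: Om_between O _.
have t0 : t < 0 by apply: (lt_le_trans t2); nra.
by rewrite !ltr0_norm// lerN2 ltW.
Qed.

(* The path goes from [(x, y)] to [(s, 0)] vertically and horizontally; when
   [s < x] it first shrinks the height so that the horizontal segment stays in
   the domain. *)
Let oscillation x y s : Om (x, y) -> a' < s < a ->
  (`|W (x, y) - W (s, 0)%R|%:E <= g y + g (y / kap)%R + (v x + v s))%E.
Proof.
have key (A B C D : \bar R) : (0 <= D -> A + B + C <= D + B + (A + C))%E.
  move=> D0; rewrite (_ : D + B + (A + C) = D + (A + B + C))%E ?leeDr//.
  by rewrite -!addeA (addeCA B).
move=> O /andP[a's sa].
have kap0 : 0 < kap by apply: lt_le_trans kap_ge1.
have [xs|sx] := leP x s.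
  have Os : Om (s, y) by apply: Om_right O xs _; exact: ltW.
  have h1 : (`|W (s, y) - W (x, y)|%:E <= g y)%E.
    apply: horizontal => // t /andP[xt ts]; apply: Om_right O _ _; first exact: ltW.
    by rewrite ltW// (lt_trans ts).
  have h2 : (`|W (s, y) - W (s, 0 * y)%R|%:E <= v s)%E.
    by apply: vertical_scale => //; rewrite lexx ler01.
  rewrite mul0r in h2.
  apply: (@le_trans _ _ (g y + v s)%E); last first.
    by apply: leeD; [exact: leeDl (g_ge0 _)|exact: leeDr (v_ge0 _)].
  apply: le_trans (leeD h1 h2); rewrite -EFinD lee_fin [X in _ <= X + _]distrC.
  exact: ler_distD.
have ax : a' < x by exact: lt_trans sx.
have kV : 0 <= kap^-1 <= 1 by rewrite invr_ge0 ltW//= invf_le1.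
have h1 : (`|W (x, y) - W (x, kap^-1 * y)%R|%:E <= v x)%E.
  exact: vertical_scale.
have h2 : (`|W (x, kap^-1 * y)%R - W (s, kap^-1 * y)%R|%:E <= g (kap^-1 * y)%R)%E.
  apply: horizontal; first exact: ltW.
  move=> t /andP[st tx]; apply: Om_shrink O _ _; last exact: ltW.
  exact: lt_trans st.
have h3 : (`|W (s, kap^-1 * y)%R - W (s, 0 * (kap^-1 * y))%R|%:E <= v s)%E.
  apply: vertical_scale => //; last by rewrite lexx ler01.
  by apply: Om_shrink O _ _ => //; exact: ltW.
rewrite mul0r in h3.
apply: (@le_trans _ _ (v x + g (kap^-1 * y)%R + v s)%E).
  apply: le_trans (leeD (leeD h1 h2) h3); rewrite -!EFinD lee_fin.
  apply: le_trans (ler_distD (W (s, kap^-1 * y)) _ _) _; rewrite lerD2r.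
  exact: ler_distD.
have ky : kap^-1 * y = y / kap by rewrite mulrC.
rewrite ky in h2 h3 *; exact: key (g_ge0 _).
Qed.

Let I1 := (\int[lebesgue2 R]_p G1 p)%E.
Let I2 := (\int[lebesgue2 R]_p G2 p)%E.

Let r_gt0 : 0 < r. Proof. by apply: lt_trans ar; exact: lt_trans a'a. Qed.

Let oscillation_integral s : a' < s < a ->
  (\int[lebesgue2 R]_(p in Om) `|W p - W (s, 0)%R|%:E <=
   (r * (1 + kap))%:E * I1 + (2 * H)%:E * I2 + (2 * H * r)%:E * v s)%E.
Proof.
move=> sI.
have -> : I1 = (\int[mu]_y g y)%E by rewrite /I1 lebesgue2_tonelli_snd.
have -> : I2 = (\int[mu]_x v x)%E by rewrite /I2 lebesgue2_tonelli_fst.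
apply: (integral_le_box r_gt0 H_ge0 (lt_le_trans ltr01 kap_ge1) mg mv g_ge0 v_ge0).
- exact: v_ge0.
- by move=> p _; rewrite lee_fin.
- move=> x y O; have /andP[x0 xr] := Om_x O; split; last exact: oscillation.
    by rewrite !ltW.
  exact: Om_y O.
Qed.

Variables (f : R -> R) (m0 : R).
Hypothesis m0_gt0 : 0 < m0.
Hypothesis f_ge : forall x, a' < x < r -> m0 <= f x.

Let J := (\int[lebesgue2 R]_(p in Om) (euclid_norm (gradA f W p))%:E)%E.

Let J_ge0 : (0 <= J)%E.
Proof. by apply: integral_ge0 => p _; rewrite lee_fin sqrtr_ge0. Qed.

Let I1_le : (I1 <= J)%E.
Proof.
rewrite /I1 /G1 -integral_mkcond; apply: ge0_integral_subset => [p _|p _|p Op].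
- by rewrite lee_fin.
- by rewrite lee_fin sqrtr_ge0.
split => //; rewrite lee_fin /euclid_norm -sqrtr_sqr ler_wsqrtr//.
by rewrite lerDl sqr_ge0.
Qed.

Let I2_le : (I2 <= (m0^-1)%:E * J)%E.
Proof.
rewrite /I2 /G2 -integral_mkcond.
apply: (@ge0_le_integralZl_ae _ _ _ _ _ _ set0) => [|p _|p _||[x y] [Op ax] _].
- by rewrite invr_gt0.
- by rewrite lee_fin.
- by rewrite lee_fin sqrtr_ge0.
- exact: negligible_set0.
split => //; rewrite -EFinM lee_fin ler_pdivlMl//.
have fx : m0 <= f x by apply: f_ge; rewrite ax; case/andP: (Om_x Op).
apply: (@le_trans _ _ `|(gradA f W (x, y)).2|).
  rewrite /gradA /= normrM ler_wpM2r//; apply: le_trans fx _; exact: ler_norm.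
by rewrite /euclid_norm -sqrtr_sqr ler_wsqrtr// lerDr sqr_ge0.
Qed.

Let Om_lty : (lebesgue2 R Om < +oo)%E.
Proof.
pose I : set (measurableTypeR R) := `[0, r]%classic.
pose I' : set (measurableTypeR R) := `[- H, H]%classic.
have mI : measurable I by exact: measurable_itv.
have mI' : measurable I' by exact: measurable_itv.
apply: (@le_lt_trans _ _ (lebesgue2 R (I `*` I'))).
  apply: le_measure; rewrite ?inE//; first exact: measurableX.
  move=> [x y] O; split; rewrite /= /I /I' /= in_itv/=.
    by case/andP: (Om_x O) => ? ?; rewrite !ltW.
  by rewrite -ler_norml; exact: Om_y O.
rewrite [ltLHS](product_measure1E _ _ mI mI').
have lI (x y : R) : (lebesgue_measure (`[x, y]%classic : set R) < +oo)%E.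
  by rewrite lebesgue_measure_itv/=; case: ifP; rewrite ?ltry// -EFinB ltry.
by apply: lte_mul_pinfty; [exact: measure_ge0|rewrite ge0_fin_numE//; exact: lI|exact: lI].
Qed.

Let Om_gt0 p : Om p -> (0 < lebesgue2 R Om)%E.
Proof.
case: p => x y O.
have /= [[A B] /= [/nbhs_ballP[e /= e0 eA] /nbhs_ballP[e' /= e'0 eB]] AB] :=
  open_nbhs_nbhs (conj oOm O).
pose I : set (measurableTypeR R) := `[x, x + e / 2]%classic.
pose I' : set (measurableTypeR R) := `[y, y + e' / 2]%classic.
have mI : measurable I by exact: measurable_itv.
have mI' : measurable I' by exact: measurable_itv.
apply: (@lt_le_trans _ _ (lebesgue2 R (I `*` I'))).
  rewrite [ltRHS](product_measure1E _ _ mI mI').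
  have lI (z d : R) : 0 < d -> (0 < lebesgue_measure (`[z, (z + d / 2)%R]%classic : set R))%E.
    move=> d0; rewrite lebesgue_measure_itv/= lte_fin ltrDl divr_gt0// -EFinB lte_fin.
    by rewrite addrAC subrr add0r divr_gt0.
  by apply: mule_gt0; exact: lI.
apply: le_measure; rewrite ?inE//; first exact: measurableX.
move=> [s t] [/=]; rewrite /I /I' /= !in_itv/= => /andP[s1 s2] /andP[t1 t2]; apply: AB; split.
  by apply: eA; rewrite /ball/= distrC ger0_norm ?subr_ge0//; lra.
by apply: eB; rewrite /ball/= distrC ger0_norm ?subr_ge0//; lra.
Qed.

Let W_integrable : (lebesgue2 R).-integrable Om (EFin \o W).
Proof.
apply: (@measurable_bounded_integrable _ (measurableTypeR R * measurableTypeR R)%type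
  R (lebesgue2 R) W Om mOm Om_lty).
  by apply: measurable_funTS; exact: continuous_measurable_prod.
exists (`|W (0, 0)| + M * (r + H)); split; first exact: num_real.
move=> K hK [x y] /= O; apply: le_trans (ltW hK).
rewrite -(subrK (W (0, 0)) (W (x, y))) addrC.
apply: (le_trans (ler_normD _ _)); rewrite lerD2l.
apply: (le_trans (W_lip (x, y) (0, 0))); rewrite ler_wpM2l//.
rewrite prod_normE /= !subr0 ge_max; have /andP[x0 xr] := Om_x O.
rewrite (gtr0_norm x0); apply/andP; split.
  by rewrite (le_trans (ltW xr))// lerDl.
by rewrite (le_trans (Om_y O))// lerDr ltW.
Qed.

(** The outer factor 2 is the price of replacing [W (s, 0)] by the average. In the last term the
    [v s] of [oscillation_integral] has been averaged over []a', a[], hence the division by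
    [a - a']. *)
Lemma planar_poincare :
  (\int[lebesgue2 R]_(p in Om) `|W p - average Om W|%:E <=
   (2 * (r * (1 + kap)) + (4 * H + 4 * H * r / (a - a')) / m0)%:E * J)%E.
Proof.
have u0 : 0 < a - a' by rewrite subr_gt0.
have kap0 : 0 < kap by apply: lt_le_trans kap_ge1.
pose c1 := r * (1 + kap); pose c2 := 2 * H; pose c3 := 2 * H * r.
have c10 : 0 <= c1 by rewrite mulr_ge0 ?(ltW r_gt0)// addr_ge0// ltW.
have c20 : 0 <= c2 by rewrite mulr_ge0.
have c30 : 0 <= c3 by rewrite mulr_ge0 ?(ltW r_gt0).
have mV0 : 0 <= m0^-1 by rewrite invr_ge0 ltW.
pose d1 := c1 + c2 * m0^-1; have d10 : 0 <= d1 by rewrite addr_ge0// mulr_ge0.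
pose d2 := 2 * c3 * m0^-1; have d20 : 0 <= d2 by rewrite mulr_ge0// mulr_ge0.
have CE : 2 * (r * (1 + kap)) + (4 * H + 4 * H * r / (a - a')) / m0 =
    (a - a')^-1 * ((a - a') * (2 * d1) + d2).
  by rewrite /d2 /d1 /c1 /c2 /c3; field; rewrite !gt_eqF.
(* The comparison with the average divides by the measure of [Om], so the empty domain is treated
   apart. *)
have [Ome|/set0P[q Oq]] := eqVneq Om set0.
  rewrite [in leLHS]Ome integral_set0 mule_ge0// lee_fin CE mulr_ge0//.
    by rewrite invr_ge0 ltW.
  by rewrite addr_ge0// mulr_ge0 ?(ltW u0)// mulr_ge0.
set T := (X in (X <= _)%E).
have T0 : (0 <= T)%E by apply: integral_ge0 => p _; rewrite lee_fin.
have I10 : (0 <= I1)%E by exact: integral_ge0.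
have I20 : (0 <= I2)%E by exact: integral_ge0.
have distJ (x y : R) : 0 <= x -> 0 <= y -> ((x + y)%:E * J = x%:E * J + y%:E * J)%E.
  by move=> x0 y0; rewrite EFinD ge0_muleDl// lee_fin.
have e1 : (c1%:E * I1 + c2%:E * I2 <= d1%:E * J)%E.
  have c2m : 0 <= c2 * m0^-1 by apply: mulr_ge0.
  rewrite (distJ c1 (c2 * m0^-1) c10 c2m); apply: leeD.
    by apply: lee_wpmul2l; rewrite ?lee_fin.
  by rewrite (EFinM c2 m0^-1) -muleA; apply: lee_wpmul2l; rewrite ?lee_fin.
have e2 : ((2 * c3)%:E * I2 <= d2%:E * J)%E.
  rewrite (EFinM (2 * c3) m0^-1) -muleA; apply: lee_wpmul2l; last exact: I2_le.
  by rewrite lee_fin mulr_ge0.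
have d10' : 0 <= 2 * d1 by apply: mulr_ge0.
have c30' : 0 <= 2 * c3 by apply: mulr_ge0.
have dJ0 : (0 <= (2 * d1)%:E * J)%E.
  by apply: mule_ge0; [rewrite lee_fin; exact: d10'|exact: J_ge0].
have cv0 x : (0 <= (2 * c3)%:E * v x)%E.
  by apply: mule_ge0; [rewrite lee_fin; exact: c30'|exact: v_ge0].
have Ts s : a' < s < a -> (T <= (2 * d1)%:E * J + (2 * c3)%:E * v s)%E.
  move=> sI.
  have h := @integral_dist_average R _ (measurableTypeR R * measurableTypeR R)%type
    (lebesgue2 R) Om W (W (s, 0)) mOm (Om_gt0 Oq) Om_lty W_integrable.
  apply: (le_trans h).
  rewrite (EFinM 2 d1) (EFinM 2 c3) -!muleA -ge0_muleDr; last 2 first.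
  - by apply: mule_ge0; [rewrite lee_fin|exact: J_ge0].
  - by apply: mule_ge0; [rewrite lee_fin|exact: v_ge0].
  rewrite lee_pmul2l//; apply: (le_trans (oscillation_integral sI)).
  by apply: leeD; [exact: e1|exact: lexx].
(* [T] does not depend on [s]: integrating [Ts] over []a', a[] gives [(a - a') * T] on the left, and
   [v] integrates to at most [I2]. *)
rewrite CE EFinM -muleA lee_pdivlMl//.
pose A : set (measurableTypeR R) := `]a', a[%classic.
have mA : measurable A by exact: measurable_itv.
have muA : mu A = (a - a')%:E.
  by rewrite [LHS]lebesgue_measure_itv/= lte_fin a'a -EFinB.
have TA : (\int[mu]_(s in A) cst T s = (a - a')%:E * T)%E.
  by rewrite integral_cst// muleC; congr (_ * _)%E; exact: muA.
rewrite -TA.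
apply: (@le_trans _ _ (\int[mu]_(s in A) (cst ((2 * d1)%:E * J) s + (2 * c3)%:E * v s))%E).
  apply: ge0_integral_subset => [s _|s _|s sA]; first exact: T0.
    by apply: adde_ge0; [exact: dJ0|exact: cv0].
  by split => //; apply: Ts; move: sA; rewrite /A /= in_itv.
have mvA : measurable_fun A v by exact: measurable_funTS.
rewrite ge0_integralD; last 5 first.
- exact: mA.
- by move=> s _; exact: dJ0.
- exact: measurable_cst.
- by move=> s _; exact: cv0.
- by apply: emeasurable_funM; [exact: measurable_cst|exact: mvA].
have ud : 0 <= (a - a') * (2 * d1) by rewrite mulr_ge0 ?(ltW u0)// mulr_ge0.
rewrite (distJ _ _ ud d20); apply: leeD.
  have -> : (((a - a') * (2 * d1))%:E * J = (a - a')%:E * ((2 * d1)%:E * J))%E.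
    by rewrite (EFinM (a - a') (2 * d1)) muleA.
  rewrite [leLHS](integral_cst mu mA) muleC.
  rewrite le_eqVlt; apply/orP; left; apply/eqP.
  by congr (_ * _)%E; exact: muA.
apply: le_trans e2.
rewrite ge0_integralZl; last 4 first.
- exact: mA.
- exact: mvA.
- by move=> s _; exact: v_ge0.
- by rewrite lee_fin; exact: c30'.
apply: lee_wpmul2l; first by rewrite lee_fin; exact: c30'.
have -> : I2 = (\int[mu]_x v x)%E by rewrite /I2 lebesgue2_tonelli_fst.
apply: ge0_integral_subset => [s _|s _|s _]; [exact: v_ge0|exact: v_ge0|by []].
Qed.

End planar_poincare.

(** * Geometry of the half ball *)

Lemma mean_value (R : realType) (h dh : R -> R) (a b : R) : a <= b ->
  (forall x, a <= x <= b -> is_derive x 1 h (dh x)) ->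
  exists2 c, a <= c <= b & h b - h a = dh c * (b - a).
Proof.
move=> ab hd; have [||c cab e] := @MVT_segment R h dh a b ab.
- by move=> x /[!in_itv]/= /andP[ax xb]; apply: hd; rewrite !ltW.
- apply: derivable_within_continuous => x /[!in_itv]/= axb.
  by apply: ex_derive; exact: hd.
by exists c => //; move: cab; rewrite in_itv.
Qed.

Section half_ball_geometry.
Variables (R : realType) (f k : R -> R) (rho : R).
Local Notation mu := (@lebesgue_measure R).
Hypothesis f_even : forall x, f (- x) = f x.
Hypothesis f0 : f 0 = 0.
Hypothesis f_gt0 : forall x, 0 < x < rho -> 0 < f x.
Hypothesis k_gt0 : forall x, 0 < x < rho -> 0 < k x.
(* Convexity of [F = - ln f], with [k = - F']. *)
Hypothesis f_tangent : forall a b, 0 < a < rho -> 0 < b < rho ->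
  f b <= f a * expR (k a * (b - a)).

(** The tangent exponential at [y] is increasing, so to the left of [y] it lies below [f y]. *)
Lemma f_homo x y : 0 <= x -> x <= y -> y < rho -> f x <= f y.
Proof.
rewrite le_eqVlt => /predU1P[<-|x0] xy yr.
  rewrite f0; move: xy; rewrite le_eqVlt => /predU1P[<-|y0]; first by rewrite f0.
  by rewrite ltW// f_gt0// y0.
have yy : 0 < y < rho by rewrite yr (lt_le_trans x0 xy).
apply: (le_trans (f_tangent yy _)); first by rewrite x0 (le_lt_trans xy).
rewrite ler_piMr ?(ltW (f_gt0 yy))// -expR0 ler_expR mulr_ge0_le0 ?subr_le0//.
by rewrite ltW// k_gt0.
Qed.

Variable r : R.
Hypothesis r_gt0 : 0 < r.
Hypothesis r_rho : r < rho.

(** The transfer principle: membership follows from a comparison of speeds. Openness takes [c > 1];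
    the other uses take [c = 1]. *)
Lemma half_ball_map x y X Y Z V K c N : half_path f r x y X Y -> 0 < c ->
  (c%:E * graph_length f X Y < r%:E)%E ->
  klip K Z -> klip K V -> Z 0 = 0 -> V 0 = 0 -> 0 < Z 1 -> mu.-negligible N ->
  (forall t, 0 < t < 1 -> ~ N t ->
    derivable X t 1 -> derivable Y t 1 -> derivable Z t 1 -> derivable V t 1 ->
    (arc_speed f (Z t) (derive1 Z t, derive1 V t) <=
     c%:E * arc_speed f (X t) (derive1 X t, derive1 Y t))%E) ->
  half_ball f r (Z 1, V 1).
Proof.
move=> [[K' [kX kY _]] _ _ _] c0 cl kZ kV Z0 V0 Z1 N0 H.
have W h K1 : K1 <= Num.max K K' -> klip K1 h -> klip (Num.max K K') h by exact: klipW.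
have m1 : K <= Num.max K K' by rewrite le_max lexx.
have m2 : K' <= Num.max K K' by rewrite le_max lexx orbT.
apply: (half_ball_intro (W _ _ m1 kZ) (W _ _ m1 kV)) => //.
apply: le_lt_trans cl.
by apply: (graph_length_le c0 (W _ _ m2 kX) (W _ _ m2 kY) (W _ _ m1 kZ) (W _ _ m1 kV) N0).
Qed.

Lemma half_ball_x_itv x y : half_ball f r (x, y) -> 0 < x < r.
Proof.
move=> /(half_ball_path f_even r_gt0)[x0 [X [Y [_ [_ _ X1 _] Xr _]]]].
by rewrite x0 -X1; case/andP: (Xr 1).
Qed.

(** Truncate the curve at abscissa [x'] and scale its height by [s]. The truncation costs at most a
    factor [c] in [f], which the factor [|s| <= 1 / c] on the vertical velocity pays for. *)
Lemma half_ball_min x y x' s c : half_ball f r (x, y) -> 0 < x' < rho -> 1 <= c ->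
  (forall z, x' <= z < r -> f z <= c * f x') -> `|s| * c <= 1 ->
  half_ball f r (Num.min x x', s * y).
Proof.
move=> /(half_ball_path f_even r_gt0)[x0 [X [Y hp]]] x'r c1 fc sc.
have [[K [kX kY _]] [X0 Y0 X1 Y1] Xr lr] := hp.
have x'0 : 0 < x' by case/andP: x'r.
pose Z t := Num.min (X t) x'; pose V t := s * Y t.
have s1 : `|s| <= 1 by apply: le_trans sc; rewrite ler_peMr.
have dZ t u : `|Z u - Z t| <= `|X u - X t| by exact: ler_dist_min.
have -> : Num.min x x' = Z 1 by rewrite /Z X1.
have -> : s * y = V 1 by rewrite /V Y1.
apply: (@half_ball_map x y X Y Z V K 1 set0) => //.
- by rewrite mul1e.
- by move=> t u; apply: le_trans (kX t u); exact: dZ.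
- move=> t u; rewrite /V -mulrBr normrM; apply: le_trans (kY t u).
  by rewrite ler_piMl.
- by rewrite /Z X0 min_l ?ltW.
- by rewrite /V Y0 mulr0.
- by rewrite /Z X1 lt_min x0.
- exact: negligible_set0.
move=> t t01 _ dX dY dZ' dV; rewrite -[1%R in leRHS]addr0.
have vv : `|derive1 V t| <= `|s| * `|derive1 Y t|.
  rewrite -[leRHS]addr0 -[X in _ + X](mul0r `|derive1 Y t|).
  apply: le_norm_derive1 => //; apply: (@filterE _ (nbhs t)) => u.
  by rewrite mul0r addr0 /V -mulrBr normrM.
apply: arc_speed_le => //.
- rewrite mul1r -[leRHS]addr0 -[X in _ + X](mul0r `|derive1 Y t|).
  rewrite -[X in X + _]mul1r; apply: le_norm_derive1 => //.
  by apply: (@filterE _ (nbhs t)) => u; rewrite mul0r addr0 mul1r; exact: dZ.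
- move=> _ Yt; apply/eqP; rewrite -normr_le0; apply: le_trans vv _.
  by rewrite Yt normr0 mulr0.
move=> fX; have Xt := Xr t.
have Xt0 : 0 < X t.
  move: Xt => /andP[]; rewrite le_eqVlt => /predU1P[Xt0|//].
  by rewrite -Xt0 f0 eqxx in fX.
have fX0 : 0 < f (X t).
  by rewrite f_gt0// Xt0; case/andP: Xt => _ /lt_trans; exact.
have fZ : 0 < f (Z t).
  by rewrite f_gt0// /Z lt_min Xt0 x'0 gt_min; case/andP: x'r => _ ->; rewrite orbT.
split; first by rewrite gt_eqF.
rewrite mul1r mul0r addr0 !normrM !normfV !(gtr0_norm fX0, gtr0_norm fZ).
rewrite ler_pdivrMr// mulrAC ler_pdivlMr//.
apply: (le_trans (ler_wpM2r (ltW fX0) vv)).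
rewrite (mulrC `|s|) -mulrA ler_wpM2l//.
have fXZ : f (X t) <= c * f (Z t).
  rewrite /Z; have [Xx|xX] := leP (X t) x'.
    by rewrite ler_peMl// ltW.
  by apply: fc; rewrite (ltW xX); case/andP: Xt.
apply: (le_trans (ler_wpM2l (normr_ge0 s) fXZ)).
by rewrite mulrA ler_piMl// ltW.
Qed.

Lemma half_ball_scale x y s : half_ball f r (x, y) -> `|s| <= 1 ->
  half_ball f r (x, s * y).
Proof.
move=> h s1; have /andP[x0 xr] := half_ball_x_itv h.
(* At [x' = r] nothing is truncated, and only the scaling is left. *)
rewrite -(min_l (ltW xr)); apply: (half_ball_min (c := 1)) => //.
- by rewrite r_gt0.
- by move=> z /andP[/le_lt_trans/[apply]]; rewrite ltxx.
- by rewrite mulr1.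
Qed.

(* The new curve follows the old one up to [t0], then stays to the right of [x]. *)
Lemma half_ball_push x1 y x X Y t0 : half_path f r x1 y X Y -> 0 < x1 -> x1 <= x ->
  0 <= t0 <= 1 -> X t0 = x -> half_ball f r (x, y).
Proof.
move=> hp x10 x1x /andP[t00 t01] Xt0.
have [[K [kX kY _]] [X0 Y0 X1 Y1] Xr lr] := hp.
have x0 : 0 < x by rewrite (lt_le_trans x10).
have K0 : 0 <= K by have := le_trans (normr_ge0 _) (kX 0 1); rewrite sub0r normrN1 mulr1.
have xr : x < r by rewrite -Xt0; case/andP: (Xr t0).
(* As [X t0 = x], this is [X t] before [t0] and [max (X t) x] after it; the single formula makes [Z]
   visibly Lipschitz. *)
pose Z t := X (Num.min t t0) + Num.max (X (Num.max t t0)) x - x.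
have Z1 : Z 1 = x.
  by rewrite /Z (min_r t01) (max_l t01) Xt0 X1 max_r//; lra.
rewrite -Z1 -Y1.
have Zl t : t <= t0 -> Z t = X t.
  by move=> tt; rewrite /Z (min_l tt) (max_r tt) Xt0 max_l//; lra.
have Zr t : t0 <= t -> Z t = Num.max (X t) x.
  by move=> tt; rewrite /Z (min_r tt) (max_l tt) Xt0; lra.
apply: (@half_ball_map x1 y X Y Z Y (K + K) 1 [set t0]) => //.
- by rewrite mul1e.
- move=> s t; rewrite /Z.
  rewrite (_ : _ - _ = (X (Num.min s t0) - X (Num.min t t0)) +
    (Num.max (X (Num.max s t0)) x - Num.max (X (Num.max t t0)) x)); last by ring.
  rewrite mulrDl; apply: (le_trans (ler_normD _ _)); apply: lerD.
    by apply: (le_trans (kX _ _)); rewrite ler_wpM2l// ler_dist_min.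
  apply: (le_trans (ler_dist_max _ _ _)); apply: (le_trans (kX _ _)).
  by rewrite ler_wpM2l// ler_dist_max.
- by apply: klipW kY; rewrite lerDl.
- by rewrite Zl.
- by rewrite Z1.
- by exists [set t0]; split => //; exact: lebesgue_measure_set1.
move=> t t_itv /eqP tt0 dX dY dZ' _; rewrite -[1%R in leRHS]addr0.
have XZ : X t <= Z t.
  have [tt|/ltW tt] := leP t t0; first by rewrite Zl.
  by rewrite Zr// le_max lexx.
apply: arc_speed_le => //.
- rewrite mul1r -[leRHS]addr0 -[X in _ + X](mul0r `|derive1 Y t|).
  rewrite -[X in X + _]mul1r; apply: le_norm_derive1 => //.
  have [lt|gt|/eqP] := ltgtP t t0; last by rewrite (negbTE tt0).
    have : \forall u \near t, u < t0 by exact: lt_nbhsl.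
    by apply: filterS => u ut; rewrite mul0r addr0 mul1r (Zl _ (ltW ut)) (Zl _ (ltW lt)).
  have : \forall u \near t, t0 < u by exact: lt_nbhsr.
  apply: filterS => u ut; rewrite mul0r addr0 mul1r (Zr _ (ltW ut)) (Zr _ (ltW gt)).
  exact: ler_dist_max.
move=> fX; have Xt := Xr t.
have Xt0' : 0 < X t.
  move: Xt => /andP[]; rewrite le_eqVlt => /predU1P[Xt0'|//].
  by rewrite -Xt0' f0 eqxx in fX.
have Zrho : Z t < rho.
  have Xrho : X t < rho by case/andP: Xt => _ /lt_trans; exact.
  have [tt|/ltW tt] := leP t t0; first by rewrite Zl.
  by rewrite Zr// gt_max Xrho (lt_trans xr).
have fX0 : 0 < f (X t) by rewrite f_gt0// Xt0' (le_lt_trans XZ).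
(* A move to the right never makes vertical motion more expensive. *)
have fXZ : f (X t) <= f (Z t) by apply: f_homo => //; exact: ltW.
have fZ : 0 < f (Z t) by exact: lt_le_trans fXZ.
split; first by rewrite gt_eqF.
rewrite mul1r mul0r addr0 !normrM !normfV !(gtr0_norm fX0, gtr0_norm fZ).
by rewrite ler_wpM2l// lef_pV2.
Qed.

Lemma derive1_affine (h : R -> R) (a b t : R) :
  {near t, h =1 (fun s => a * s + b)} -> derive1 h t = a.
Proof.
move=> hE; rewrite (near_eq_derive1 hE) derive1E.
have d : is_derive t 1 (fun s : R => a * s + b) a.
  by apply: is_derive_eq; rewrite ?scaler0 ?addr0 ?add0r /GRing.scale/= ?mulr1 ?mulr0 ?addr0.
exact: derive_val.
Qed.

(* Go right to [z], up to height [y], and back to [x]. *)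
Lemma half_ball_rect x y z : 0 < x -> x <= z -> z < rho ->
  2 * z - x + `|y| / f z < r -> half_ball f r (x, y).
Proof.
move=> x0 xz zrho lr.
have z0 : 0 < z by exact: lt_le_trans xz.
have fz : 0 < f z by rewrite f_gt0// z0.
pose c := @unit_clamp R.
have c0 t : t <= 0 -> c t = 0.
  by move=> t0; rewrite /c /unit_clamp max_l// ge_min t0 orbT.
have c1 t : 1 <= t -> c t = 1.
  by move=> t1; rewrite /c /unit_clamp min_l// max_r.
have cid t : 0 <= t <= 1 -> c t = t by exact: unit_clamp_id.
(* Each third of [[0, 1]] carries one side of the path: the first clamp moves the abscissa to [z],
   the clamp in [Y] climbs, and the last one brings the abscissa back to [x]. *)
pose X t := z * c (3 * t) - (z - x) * c (3 * t - 2).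
pose Y t := y * c (3 * t - 1).
have ck (a b s t : R) : `|a * c (3 * s - b) - a * c (3 * t - b)| <= 3 * `|a| * `|s - t|.
  rewrite -mulrBr normrM [leRHS](_ : _ = `|a| * (3 * `|s - t|)); last by ring.
  rewrite ler_wpM2l//.
  apply: (le_trans (klip_unit_clamp _ _)).
  by rewrite mul1r (_ : _ - _ = 3 * (s - t)) ?normrM ?(ger0_norm (_ : 0 <= 3))//; ring.
pose K := 3 * `|z| + 3 * `|z - x| + 3 * `|y|.
have kX : klip K X.
  move=> s t.
  have := ck z 0 s t; have := ck (z - x) 2 s t; rewrite !subr0 => h1 h2.
  rewrite (_ : X s - X t = (z * c (3 * s) - z * c (3 * t)) -
    ((z - x) * c (3 * s - 2) - (z - x) * c (3 * t - 2))); last by rewrite /X; ring.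
  apply: (le_trans (ler_normB _ _)).
  have h3 : 0 <= 3 * `|y| * `|s - t| by rewrite !mulr_ge0.
  by rewrite /K (mulrDl _ (3 * `|y|)) (mulrDl (3 * `|z|)); lra.
have kY : klip K Y.
  move=> s t; apply: (le_trans (ck y 1 s t)).
  by rewrite ler_wpM2r// /K lerDr addr_ge0// mulr_ge0.
have X0 : X 0 = 0 by rewrite /X !c0 ?mulr0 ?subr0//; lra.
have Y0 : Y 0 = 0 by rewrite /Y c0 ?mulr0//; lra.
have X1 : X 1 = x by rewrite /X !c1; lra.
have Y1 : Y 1 = y by rewrite /Y c1; lra.
rewrite -X1 -Y1; apply: (half_ball_intro kX kY) => //; first by rewrite X1.
(* The speed of the path away from the breakpoints; each third contributes the length of one
   side. *)
pose U (t : R) : R := if t < 3^-1 then 3 * z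
  else if t < 2 / 3 then 3 * (`|y| / f z) else 3 * (z - x).
have mU : measurable_fun setT (EFin \o U).
  apply/measurable_EFinP; apply: measurable_fun_ifT.
  - exact: measurable_fun_ltr.
  - exact: measurable_cst.
  apply: measurable_fun_ifT; [exact: measurable_fun_ltr|exact: measurable_cst|exact: measurable_cst].
have U0 (t : R) : 0 <= U t.
  by rewrite /U; case: ifP => _; [|case: ifP => _]; rewrite mulr_ge0// ?subr_ge0 ?divr_ge0// ltW.
have intU : (\int[mu]_(t in `[0%R, 1%R]) (U t)%:E = (2 * z - x + `|y| / f z)%:E)%E.
  have -> : `[0%R, 1%R]%classic = `[0%R, 3^-1[ `|` (`[3^-1, 2 / 3[ `|` `[2 / 3, 1%R]) :> set R.
    apply/seteqP; split => t /=; rewrite !in_itv/=.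
      move=> /andP[t0 t1]; have [t3|t3] := ltP t 3^-1; first by left; rewrite t0.
      by right; have [t23|t23] := ltP t (2 / 3); [left|right; rewrite t1].
    by move=> [|[|]] /andP[? ?]; apply/andP; split; lra.
  have i1 : mu (`[0%R, 3^-1[%classic : set R) = (3^-1)%:E.
    by rewrite lebesgue_measure_itv/= lte_fin ifT ?invr_gt0// -EFinB subr0.
  have i2 : mu (`[3^-1, 2 / 3[%classic : set R) = (3^-1)%:E.
    by rewrite lebesgue_measure_itv/= lte_fin ifT -?EFinB; [congr EFin|]; lra.
  have i3 : mu (`[2 / 3, 1]%classic : set R) = (3^-1)%:E.
    by rewrite lebesgue_measure_itv/= lte_fin ifT -?EFinB; [congr EFin|]; lra.
  have icst (A : set (measurableTypeR R)) (a : R) : measurable A -> mu A = (3^-1)%:E ->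
      (forall t, A t -> U t = 3 * a) -> (\int[mu]_(t in A) (U t)%:E = a%:E)%E.
    move=> mA A3 UA; transitivity (\int[mu]_(t in A) cst (3 * a)%:E t)%E.
      by apply: eq_integral => t /set_mem /UA ->.
    rewrite integral_cst//; transitivity ((3 * a)%:E * (3^-1)%:E)%E.
      by congr (_ * _)%E; exact: A3.
    by rewrite -EFinM; congr EFin; field.
  rewrite ge0_integral_setU//=; last 4 first.
  - by apply: measurableU; exact: measurable_itv.
  - exact: measurable_funTS.
  - by move=> t _; rewrite lee_fin.
  - apply/disj_set2P/seteqP; split => // t /= [].
    by rewrite !in_itv/= => /andP[? ?] [|] /andP[? ?]; lra.
  rewrite ge0_integral_setU//=; last 3 first.
  - exact: measurable_funTS.
  - by move=> t _; rewrite lee_fin.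
  - apply/disj_set2P/seteqP; split => // t /= [].
    by rewrite !in_itv/= => /andP[? ?] /andP[? ?]; lra.
  rewrite (icst _ z) => [| |//|t]; last 2 first.
  - exact: measurable_itv.
  - by rewrite /= in_itv/= /U => /andP[_ ->].
  rewrite (icst _ (`|y| / f z)) => [| |//|t]; last 2 first.
  - exact: measurable_itv.
  - by rewrite /= in_itv/= /U => /andP[t3 ->]; rewrite ltNge t3.
  rewrite (icst _ (z - x)) => [| |//|t]; last 2 first.
  - exact: measurable_itv.
  - rewrite /= in_itv/= /U => /andP[t3 _]; rewrite ltNge (ltNge t) t3/=.
    by rewrite (le_trans _ t3)//; lra.
  by rewrite -!EFinD; congr EFin; ring.
rewrite -lte_fin -intU in lr; apply: le_lt_trans lr.
pose N : set (measurableTypeR R) := [set 0] `|` [set 3^-1] `|` [set 2 / 3] `|` [set 1].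
have s0 (a : R) : mu.-negligible ([set a] : set (measurableTypeR R)).
  by exists [set a]; split => //; exact: lebesgue_measure_set1.
apply: (@ge0_le_integral_ae _ _ _ _ _ _ N).
- by move=> t _; exact: arc_speed_ge0.
- by move=> t _; rewrite lee_fin.
- by apply: negligibleU (s0 1); apply: negligibleU (s0 (2 / 3)); exact: negligibleU (s0 0) (s0 3^-1).
move=> t t01 /not_orP[/not_orP[/not_orP[t0 t13] t23] t1]; split => //.
move: t01; rewrite /= in_itv/= => /andP[t0' t1'].
have {t0}t0 : 0 < t by rewrite lt_neqAle t0' andbT; apply/eqP => e; apply: t0.
have {t1}t1 : t < 1 by rewrite lt_neqAle t1' andbT; apply/eqP => e; apply: t1.
have speedx u w : arc_speed f w (u, 0) = `|u|%:E.
  by rewrite /arc_speed /= eqxx andbF mul0r expr0n addr0 sqrtr_sqr.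
rewrite /U; case: ltP => [t3|]; last rewrite le_eqVlt => /predU1P[te|t3]; last first.
- case: ltP => [t2|]; last rewrite le_eqVlt => /predU1P[te|t2]; last first.
  + rewrite (@derive1_affine X (- (3 * (z - x))) (z + 2 * (z - x))); last first.
      have := near_in_itvoo (_ : t \in `]2 / 3, 1[%R); rewrite in_itv/= t1 t2 => /(_ isT).
      apply: filterS => s; rewrite in_itv/= => /andP[s1 s2].
      by rewrite /X c1 ?cid; [ring| |]; lra.
    rewrite (@derive1_affine Y 0 y); last first.
      have := near_in_itvoo (_ : t \in `]2 / 3, 1[%R); rewrite in_itv/= t1 t2 => /(_ isT).
      apply: filterS => s; rewrite in_itv/= => /andP[s1 s2].
      by rewrite /Y c1; lra.
    by rewrite speedx normrN ger0_norm// mulr_ge0// subr_ge0.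
  + by exfalso; apply: t23.
  + rewrite (@derive1_affine X 0 z); last first.
      have := near_in_itvoo (_ : t \in `]3^-1, 2 / 3[%R); rewrite in_itv/= t3 t2 => /(_ isT).
      apply: filterS => s; rewrite in_itv/= => /andP[s1 s2].
      by rewrite /X c1 ?c0; [ring| |]; lra.
    rewrite (@derive1_affine Y (3 * y) (- y)); last first.
      have := near_in_itvoo (_ : t \in `]3^-1, 2 / 3[%R); rewrite in_itv/= t3 t2 => /(_ isT).
      apply: filterS => s; rewrite in_itv/= => /andP[s1 s2].
      by rewrite /Y cid; [ring|]; lra.
    have -> : X t = z by rewrite /X c1 ?c0; [ring| |]; lra.
    rewrite /arc_speed /= (gt_eqF fz)/= expr0n add0r sqrtr_sqr lee_fin.
    by rewrite !normrM normfV (gtr0_norm fz) (ger0_norm (_ : 0 <= 3))// mulrA.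
- by exfalso; apply: t13.
rewrite (@derive1_affine X (3 * z) 0); last first.
  have := near_in_itvoo (_ : t \in `]0, 3^-1[%R); rewrite in_itv/= t0 t3 => /(_ isT).
  apply: filterS => s; rewrite in_itv/= => /andP[s1 s2].
  by rewrite /X cid ?c0; [ring| |]; lra.
rewrite (@derive1_affine Y 0 0); last first.
  have := near_in_itvoo (_ : t \in `]0, 3^-1[%R); rewrite in_itv/= t0 t3 => /(_ isT).
  apply: filterS => s; rewrite in_itv/= => /andP[s1 s2].
  by rewrite /Y c0; lra.
by rewrite speedx ger0_norm// mulr_ge0// ltW.
Qed.

(** * Openness of the half ball *)

Lemma k_nincr a b : 0 < a -> a <= b -> b < rho -> k b <= k a.
Proof.
move=> a0; rewrite le_eqVlt => /predU1P[->//|ab] br.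
have ar : 0 < a < rho by rewrite a0 (lt_trans ab).
have br' : 0 < b < rho by rewrite (lt_trans a0).
have fa := f_gt0 ar; have h1 := f_tangent ar br'; have h2 := f_tangent br' ar.
(* The tangent inequalities at [a] and [b] multiply to [1 <= expR ((k a - k b) * (b - a))]. *)
have := le_trans h2 (ler_wpM2r (expR_ge0 _) h1).
rewrite -mulrA -expRD ler_pMr// -expR0 ler_expR.
rewrite (_ : _ + _ = (k a - k b) * (b - a)); last by ring.
by rewrite pmulr_lge0 ?subr_gt0// subr_ge0.
Qed.

(** The curve is displaced by a cutoff times [(e, g)], so that it ends at the new point and is
    unchanged up to abscissa [x0 / 2], away from the degeneracy at 0. The speed grows by a factor
    that tends to 1 with [d], while the length is strictly below [r]. *)
Lemma half_ball_nbhs (x0 y0 : R) : half_ball f r (x0, y0) ->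
  nbhs (x0, y0) (half_ball f r).
Proof.
move=> h; have [rp rr] := (r_gt0, r_rho); have /andP[x00 x0r] := half_ball_x_itv h.
have [_ [X [Y hp]]] := half_ball_path f_even r_gt0 h.
have [[K [kX kY _]] [X0 Y0 X1 Y1] Xr lr] := hp.
have K0 : 0 <= K by have := le_trans (normr_ge0 _) (kX 0 1); rewrite sub0r normrN1 mulr1.
have [L lL] : exists L, graph_length f X Y = L%:E.
  exists (fine (graph_length f X Y)); rewrite fineK// ge0_fin_numE ?(lt_le_trans lr) ?leey//.
  by apply: integral_ge0 => t _; exact: arc_speed_ge0.
have Lr : L < r by rewrite -lte_fin -lL.
have x4 : 0 < x0 / 4 by rewrite divr_gt0.
have x4r : 0 < x0 / 4 < rho by rewrite x4/=; lra.
have f4 : 0 < f (x0 / 4) by rewrite f_gt0.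
have k4 : 0 < k (x0 / 4) by rewrite k_gt0.
(* [2 / x0] is the Lipschitz constant of the cutoff, and [k (x0 / 4)] bounds [k] to the right of
   [x0 / 4], where the displaced part of the curve lies. [B] bounds the vertical velocity created by
   the cutoff, measured with [f >= f (x0 / 4)]. *)
pose A := Num.max (2 / x0) (k (x0 / 4)).
pose B := (2 / x0) / f (x0 / 4).
have [d [d0 d4 dr dL]] : exists d, [/\ 0 < d, d <= x0 / 4, d < rho - r &
    (expR (A * d) + B * d) * L < r].
  have : (fun d => (expR (A * d) + B * d) * L) d @[d --> 0^'+] -->
      (expR (A * 0) + B * 0) * L.
    apply: cvg_at_right_filter; apply: cvgM; last exact: cvg_cst.
    apply: cvgD; last by apply: cvgM; [exact: cvg_cst|exact: cvg_id].
    apply: (@continuous_comp _ _ _ (fun d => A * d) expR); last exact: continuous_expR.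
    by apply: cvgM; [exact: cvg_cst|exact: cvg_id].
  rewrite mulr0 expR0 mulr0 addr0 mul1r => /cvgr_lt /(_ _ Lr) H.
  have [d [dd d1 d2 d3]] : exists d, [/\ (expR (A * d) + B * d) * L < r, 0 < d,
      d < x0 / 4 & d < rho - r].
    apply: (@filter_ex _ (0 : R)^'+); near=> d; split; near: d => //.
    - exact: nbhs_right_gt.
    - exact: nbhs_right_lt.
    - by apply: nbhs_right_lt; rewrite subr_gt0.
  by exists d; rewrite d1 d3 ltW.
exists (ball x0 d, ball y0 d) => /=; first by split; exact: nbhsx_ballx.
move=> [x y] [/= + +]; rewrite /ball/= => xd yd.
pose e := x - x0; pose g := y - y0.
have ed : `|e| < d by rewrite /e distrC.
have gd : `|g| < d by rewrite /g distrC.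
pose q t := unit_clamp (2 / x0 * t - 1).
have q01 t : 0 <= q t <= 1 by exact: unit_clamp_itv.
have q0 t : t <= x0 / 2 -> q t = 0.
  move=> tx; rewrite /q /unit_clamp max_l// ge_min; apply/orP; right.
  by rewrite subr_le0 mulrAC ler_pdivrMr//; lra.
have q1 : q x0 = 1.
  rewrite /q mulfVK ?gt_eqF// /unit_clamp (_ : 2 - 1 = 1 :> R); last by lra.
  by rewrite min_l// max_r.
have kq s t : `|q s - q t| <= 2 / x0 * `|s - t|.
  apply: (le_trans (klip_unit_clamp _ _)); rewrite mul1r.
  rewrite (_ : _ - _ = 2 / x0 * (s - t)); last by ring.
  by rewrite normrM (ger0_norm (_ : 0 <= 2 / x0))// divr_ge0// ltW.
pose Z t := X t + e * q (X t); pose V t := Y t + g * q (X t).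
have dq (c : R) s t : `|c * q (X s) - c * q (X t)| <= `|c| * (2 / x0) * `|X s - X t|.
  by rewrite -mulrBr normrM -mulrA ler_wpM2l.
have kq' (c : R) : klip (`|c| * (2 / x0) * K) (fun t => c * q (X t)).
  move=> s t; apply: (le_trans (dq _ _ _)); rewrite -(mulrA _ K) ler_wpM2l//.
  by rewrite mulr_ge0// divr_ge0// ltW.
have x20 : 0 <= 2 / x0 by rewrite divr_ge0 ?(ltW x00).
pose K' := K + (`|e| + `|g|) * (2 / x0) * K.
have kZ : klip K' Z.
  move=> s t.
  rewrite (_ : Z s - Z t = (X s - X t) + (e * q (X s) - e * q (X t))); last first.
    by rewrite /Z; ring.
  apply: (le_trans (ler_normD _ _)); rewrite /K' (mulrDl K); apply: lerD => //.
  apply: (le_trans (kq' _ _ _)).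
  rewrite (mulrDl `|e|) (mulrDl (_ * _) (_ * _) K) (mulrDl (_ * K)) lerDl.
  by rewrite mulr_ge0// mulr_ge0// mulr_ge0.
have kV : klip K' V.
  move=> s t.
  rewrite (_ : V s - V t = (Y s - Y t) + (g * q (X s) - g * q (X t))); last first.
    by rewrite /V; ring.
  apply: (le_trans (ler_normD _ _)); rewrite /K' (mulrDl K); apply: lerD => //.
  apply: (le_trans (kq' _ _ _)).
  rewrite (mulrDl `|e|) (mulrDl (_ * _) (_ * _) K) (mulrDl (_ * K)) lerDr.
  by rewrite mulr_ge0// mulr_ge0// mulr_ge0.
have Z1 : Z 1 = x by rewrite /Z X1 q1 /e; ring.
have V1 : V 1 = y by rewrite /V X1 Y1 q1 /g; ring.
rewrite -Z1 -V1.
have A0 : 0 <= A by rewrite le_max x20.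
have B0 : 0 < B by rewrite divr_gt0// divr_gt0.
have c0 : 0 < expR (A * d) + B * d by rewrite addr_gt0 ?expR_gt0// mulr_gt0.
apply: (@half_ball_map x0 y0 X Y Z V K' (expR (A * d) + B * d) set0) => //.
- by rewrite lL -EFinM lte_fin.
- by rewrite /Z X0 q0 ?mulr0 ?addr0//; lra.
- by rewrite /V X0 Y0 q0 ?mulr0 ?addr0//; lra.
- by rewrite Z1; move: ed; rewrite /e ltr_norml => /andP[? _]; lra.
- exact: negligible_set0.
move=> t t01 _ dX dY dZ dV.
have eA : 1 + (2 / x0) * `|e| <= expR (A * d).
  apply: (le_trans _ (expR_ge1Dx _)); rewrite lerD2l; apply: ler_pM => //; last exact: ltW.
  by rewrite le_max lexx.
have Z' : `|derive1 Z t| <= expR (A * d) * `|derive1 X t|.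
  apply: (@le_trans _ _ ((1 + (2 / x0) * `|e|) * `|derive1 X t|)); last by rewrite ler_wpM2r.
  rewrite -[leRHS]addr0 -[X in _ + X](mul0r `|derive1 Y t|).
  apply: le_norm_derive1 => //; apply: (@filterE _ (nbhs t)) => s.
  rewrite mul0r addr0 mulrDl mul1r.
  rewrite (_ : Z s - Z t = (X s - X t) + (e * q (X s) - e * q (X t))); last by rewrite /Z; ring.
  by apply: (le_trans (ler_normD _ _)); rewrite lerD2l (mulrC (2 / x0)); exact: dq.
have cX : {for t, continuous X} by exact: klip_continuous kX t.
have /andP[Xt0 Xtr] := Xr t.
have e1 : 1 <= expR (A * d) by rewrite -expR0 ler_expR mulr_ge0// ltW.
(* Left of [x0 / 2] the cutoff vanishes around [X t]: the new curve coincides with the old one near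
   [t]. *)
have [Xt|Xt] := ltP (X t) (x0 / 2).
  have V' : `|derive1 V t| <= 1 * `|derive1 Y t|.
    rewrite -[leRHS]addr0 -[X in _ + X](mul0r `|derive1 Y t|).
    apply: le_norm_derive1 => //.
    have near1 : nbhs t [set s | X s < x0 / 2] by exact: (@cvgr_lt _ _ (nbhs t) _ X (X t) cX).
    apply: (filterS _ near1) => s /= Xs.
    by rewrite mul0r addr0 /V !q0 ?mulr0 ?addr0 ?mul1r// ltW.
  apply: arc_speed_le => //; first exact: expR_gt0.
  - by rewrite mulr_ge0 ?ltW.
  - by move=> _ Yt; apply/eqP; rewrite -normr_le0 (le_trans V')// Yt normr0 mulr0.
  rewrite (_ : Z t = X t); last by rewrite /Z q0 ?mulr0 ?addr0// ltW.
  move=> fX; split => //; rewrite -[leLHS]addr0.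
  apply: lerD; last by apply: mulr_ge0 => //; apply: mulr_ge0; exact: ltW.
  rewrite !normrM mulrA ler_wpM2r//; apply: (le_trans V').
  by rewrite ler_wpM2r.
have V' : `|derive1 V t| <= 1 * `|derive1 Y t| + (d * (2 / x0)) * `|derive1 X t|.
  apply: le_norm_derive1 => //; apply: (@filterE _ (nbhs t)) => s.
  rewrite mul1r.
  rewrite (_ : V s - V t = (Y s - Y t) + (g * q (X s) - g * q (X t))); last by rewrite /V; ring.
  apply: (le_trans (ler_normD _ _)); rewrite lerD2l; apply: (le_trans (dq _ _ _)).
  by rewrite ler_wpM2r// ler_wpM2r// ltW.
have Xt0' : 0 < X t by lra.
have fX : 0 < f (X t) by rewrite f_gt0// Xt0' (lt_trans Xtr).
have /andP[qt0 qt1] := q01 (X t).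
have eq1 : `|e * q (X t)| <= d.
  by rewrite normrM (ger0_norm qt0); apply: le_trans (ltW ed); rewrite ler_piMr.
have := eq1; rewrite ler_norml => /andP[eq2 eq3].
have Z4 : x0 / 4 <= Z t by rewrite /Z; lra.
have Zrho : Z t < rho by rewrite /Z; lra.
have Z0 : 0 < Z t by lra.
have fZ4 : f (x0 / 4) <= f (Z t) by apply: f_homo => //; exact: ltW.
have fZ : 0 < f (Z t) by exact: lt_le_trans fZ4.
have Zr : 0 < Z t < rho by rewrite Z0.
have Xrho : 0 < X t < rho by rewrite Xt0' (lt_trans Xtr).
(* Only a displacement to the left loses in [f]; the tangent exponential at [Z t] bounds the
   loss. *)
have fXZ : f (X t) <= f (Z t) * expR (A * d).
  have [XZ|ZX] := leP (X t) (Z t).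
    apply: (@le_trans _ _ (f (Z t))); first by apply: f_homo.
    by rewrite ler_peMr// ltW.
  apply: (le_trans (f_tangent Zr Xrho)); rewrite ler_wpM2l ?(ltW fZ)// ler_expR.
  apply: ler_pM; [by rewrite ltW ?k_gt0|by rewrite subr_ge0 ltW| |by rewrite /Z; lra].
  by rewrite le_max; apply/orP; right; apply: k_nincr.
apply: arc_speed_le => //; first exact: expR_gt0.
- by rewrite mulr_ge0 ?ltW.
- by move=> fX0; rewrite fX0 ltxx in fX.
move=> _; split; first by rewrite gt_eqF.
rewrite !normrM !normfV (gtr0_norm fX) (gtr0_norm fZ).
apply: (@le_trans _ _ ((1 * `|derive1 Y t| + (d * (2 / x0)) * `|derive1 X t|) / f (Z t))).
  by rewrite ler_wpM2r// invr_ge0 ltW.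
rewrite mul1r mulrDl; apply: lerD.
  by rewrite [leRHS]mulrCA ler_wpM2l// ler_pdivlMr// [leLHS]mulrC ler_pdivrMr// mulrC.
rewrite mulrAC ler_wpM2r// /B (mulrC d) -!mulrA ler_wpM2l//.
by rewrite ler_wpM2l ?invr_ge0 ?(ltW x00)// mulrC ler_wpM2r ?(ltW d0)// lef_pV2.
Unshelve. all: by end_near. Qed.

Lemma half_ball_open : open (half_ball f r).
Proof. by rewrite openE => -[x y]; exact: half_ball_nbhs. Qed.

(** * Height of the half ball *)

Lemma klip_comp (G dG X : R -> R) (m M B K : R) : 0 <= B ->
  (forall u, m <= u <= M -> is_derive u 1 G (dG u)) ->
  (forall u, m <= u <= M -> `|dG u| <= B) ->
  (forall t, m <= X t <= M) -> klip K X -> klip (B * K) (G \o X).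
Proof.
move=> B0 GdG dGB Xm kX s t /=.
apply: (@le_trans _ _ (B * `|X s - X t|)); last first.
  by rewrite -mulrA ler_wpM2l.
wlog st : s t / X s <= X t.
  by move=> H; have [/H//|/ltW/H] := leP (X s) (X t); rewrite distrC (distrC (X t)).
have /andP[ms _] := Xm s; have /andP[_ tM] := Xm t.
have sub u : X s <= u <= X t -> m <= u <= M.
  by move=> /andP[a b]; rewrite (le_trans ms a) (le_trans b tM).
rewrite [leLHS]distrC [in leRHS]distrC.
have [u /sub|c cX ->] := @mean_value R G dG (X s) (X t) st; first exact: GdG.
by rewrite normrM ler_wpM2r//; apply: dGB; exact: sub.
Qed.

(* With [e = expR (k * (X - x))] and [w2 = 2 * cosh (c * Y)], this bounds by
   [2 * k] the derivative of [ln P] along a curve of velocity [(U, w * f X)]. *)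
Lemma calibration_ineq (e S U w : R) (P w2 : R) : 0 <= e -> e <= 1 ->
  2 <= w2 -> S ^+ 2 = w2 ^+ 2 - 4 -> P = 4 * e ^+ 2 + w2 - 2 ->
  4 * e ^+ 2 * `|U| + `|S| * e * `|w| <= P * Num.sqrt (U ^+ 2 + w ^+ 2).
Proof.
move=> e0 e1 w22 SE PE.
have P0 : 0 <= P by rewrite PE; have := sqr_ge0 e; lra.
have l0 : 0 <= 4 * e ^+ 2 * `|U| + `|S| * e * `|w|.
  by rewrite addr_ge0// !mulr_ge0// exprn_ge0.
rewrite -[leLHS]ger0_norm// -sqrtr_sqr -[P]ger0_norm// -[`|P|]sqrtr_sqr -sqrtrM ?sqr_ge0//.
apply: ler_wsqrtr.
have E1 : e ^+ 2 <= 1 by rewrite expr_le1.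
have E0 : 0 <= e ^+ 2 by rewrite sqr_ge0.
rewrite -(real_normK (num_real U)) -(real_normK (num_real w)).
rewrite -(real_normK (num_real S)) in SE.
set u := `|U|; set v := `|w|; set T := `|S| in SE *.
(* Cauchy-Schwarz; the remaining difference then factors into terms that are nonnegative because
   [E <= 1]. *)
apply: (@le_trans _ _ ((16 * e ^+ 4 + T ^+ 2 * e ^+ 2) * (u ^+ 2 + v ^+ 2))).
  rewrite -subr_ge0.
  rewrite (_ : _ - _ = (4 * e ^+ 2 * v - T * e * u) ^+ 2); last by ring.
  exact: sqr_ge0.
rewrite ler_wpM2r ?addr_ge0 ?sqr_ge0// SE PE (_ : e ^+ 4 = (e ^+ 2) ^+ 2); last by ring.
set E := e ^+ 2 in E0 E1 *.
rewrite -subr_ge0 (_ : _ - _ = (w2 - 2) * ((w2 - 2) * (1 - E) + 4 * E)); last by ring.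
by rewrite mulr_ge0 ?subr_ge0// addr_ge0 ?mulr_ge0// subr_ge0.
Qed.

(** Along the curve [ln P] grows by at most [2 * k x * r]. It starts from
    [P 0 = 4 * expR (- 2 * k x * x)], while [P 1 + 2] dominates [expR (c * |y|)]; a logarithm then
    bounds [|y|]. *)
Lemma half_path_height x1 y X Y x : half_path f r x1 y X Y -> 0 < x -> x <= r ->
  (forall t, X t <= x) -> k x * `|y| / f x <= k x * (r - x) + 3.
Proof.
move=> [[K [kX kY YK]] [X0 Y0 X1 Y1] Xr lr] x0 xr Xx.
have xrho : 0 < x < rho by rewrite x0 (le_lt_trans xr).
have fx : 0 < f x by exact: f_gt0.
have kx : 0 < k x by exact: k_gt0.
have K0 : 0 <= K by apply: le_trans (YK 0).
have [q qE] : exists q, q = 2 * k x by exists (2 * k x).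
have q0 : 0 < q by rewrite qE mulr_gt0.
have [c cE] : exists c, c = 2 * (k x / f x) by exists (2 * (k x / f x)).
have c0 : 0 < c by rewrite cE mulr_gt0// divr_gt0.
(* For [f] replaced by its tangent exponential at [x] the control metric is
   hyperbolic, and [ln P / q] is 1-Lipschitz for it. *)
pose E t := expR (q * (X t - x)).
pose P t := 4 * E t + expR (c * Y t) + expR (- c * Y t) - 2.
have E1 t : E t <= 1 by rewrite -expR0 ler_expR mulr_ge0_le0 ?subr_le0// ltW.
have Em t : expR (- q * x) <= E t.
  rewrite ler_expR mulNr -mulrN ler_wpM2l ?(ltW q0)//.
  by rewrite lerBrDr addNr; case/andP: (Xr t).
have cosh2 (u : R) : 2 <= expR u + expR (- u).
  have := expR_gt0 u; have : expR u * expR (- u) = 1 by rewrite -expRD subrr expR0.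
  have := sqr_ge0 (expR u - expR (- u)); have := expR_gt0 (- u); nra.
pose m := 4 * expR (- q * x); have m0 : 0 < m by rewrite mulr_gt0// expR_gt0.
have mP t : m <= P t.
  rewrite /P /m; have := cosh2 (c * Y t); rewrite -mulNr.
  by have := Em t; lra.
pose M := 4 + 2 * expR (c * K).
have PM t : P t <= M.
  have := YK t; rewrite ler_norml => /andP[Y1' Y2'].
  have h1 : expR (c * Y t) <= expR (c * K) by rewrite ler_expR ler_wpM2l// ltW.
  have h2 : expR (- c * Y t) <= expR (c * K).
    by rewrite ler_expR mulNr -mulrN ler_wpM2l ?(ltW c0)// lerNl.
  by rewrite /P /M; have := E1 t; lra.
have dexp (a b u : R) : is_derive u 1 (fun u => expR (a * (u - b))) (a * expR (a * (u - b))).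
  by apply: is_derive_eq; rewrite ?scaler0 ?subr0 ?addr0 ?add0r /GRing.scale/= mulr1 mulrC.
have dc (a u : R) : is_derive u 1 (fun u => expR (a * u)) (a * expR (a * u)).
  have -> : (fun u => expR (a * u)) = (fun u => expR (a * (u - 0))).
    by apply/funext => v; rewrite subr0.
  by have := dexp a 0 u; rewrite subr0.
have kP : exists K', klip K' P.
  have kE : klip (q * K) E.
    apply: (@klip_comp _ (fun u => q * expR (q * (u - x))) X 0 x) => //; first exact: ltW.
      move=> u /andP[_ ux]; rewrite ger0_norm; last by apply: mulr_ge0; [exact: ltW|exact: expR_ge0].
      by rewrite ler_piMr ?(ltW q0)// -expR0 ler_expR mulr_ge0_le0 ?subr_le0// ltW.
    by move=> t; rewrite Xx; case/andP: (Xr t) => ->.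
  have kc (a : R) : klip (`|a| * expR (`|a| * K) * K) (fun t => expR (a * Y t)).
    apply: (@klip_comp _ (fun u => a * expR (a * u)) Y (- K) K) => //.
    - move=> u uK; rewrite normrM ler_wpM2l// ger0_norm ?expR_ge0// ler_expR.
      by rewrite (le_trans (ler_norm _))// normrM ler_wpM2l// ler_norml.
    - by move=> t; rewrite -ler_norml.
  exists (4 * (q * K) + `|c| * expR (`|c| * K) * K + `|- c| * expR (`|- c| * K) * K).
  move=> s t; rewrite !(mulrDl _ _ `|s - t|).
  rewrite (_ : P s - P t = 4 * (E s - E t) + (expR (c * Y s) - expR (c * Y t)) +
    (expR (- c * Y s) - expR (- c * Y t))); last by rewrite /P; ring.
  apply: (le_trans (ler_normD _ _)); apply: lerD; last exact: kc.
  apply: (le_trans (ler_normD _ _)); apply: lerD; last exact: kc.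
  by rewrite normrM (ger0_norm (_ : 0 <= 4))// -[leRHS]mulrA ler_wpM2l//; exact: kE.
have [K' kP'] := kP.
have kL : klip (m^-1 * K') (ln (R:=R) \o P).
  apply: (@klip_comp (@ln R) (fun u : R => u^-1) P m M) => //.
  - by rewrite invr_ge0 ltW.
  - by move=> u /andP[mu _]; apply: is_derive1_ln; exact: lt_le_trans mu.
  - move=> u /andP[mu _]; rewrite gtr0_norm ?invr_gt0 ?(lt_le_trans m0)//.
    by rewrite lef_pV2// posrE (lt_le_trans m0).
  - by move=> t; rewrite mP PM.
have key : (`|ln (P 1) - ln (P 0)|%:E <= q%:E * graph_length f X Y)%E.
  pose D (h : R -> R) : set (measurableTypeR R) := [set t | ~ derivable h t 1].
  pose u t := (q%:E * arc_speed f (X t) (derive1 X t, derive1 Y t))%E.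
  have u0 t : (0 <= u t)%E by rewrite mule_ge0 ?arc_speed_ge0// lee_fin ltW.
  apply: (@le_trans _ _ (\int[mu]_(t in `[0%R, 1%R]) u t)%E); last first.
    apply: (ge0_le_integralZl_ae (N := set0)) => //.
    - by move=> t _; exact: arc_speed_ge0.
    - exact: negligible_set0.
  apply: (klip_le_integral kL (N := D X `|` D Y)) => //.
    by apply: negligibleU; [exact: klip_ae_derivable kX|exact: klip_ae_derivable kY].
  move=> t _ /not_orP[/contrapT dX /contrapT dY] _.
  have hX : is_derive t 1 X (derive1 X t) by rewrite derive1E; exact: derivableP.
  have hY : is_derive t 1 Y (derive1 Y t) by rewrite derive1E; exact: derivableP.
  have hE := is_derive1_comp (dexp q x (X t)) hX.
  have h1 := is_derive1_comp (dc c (Y t)) hY.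
  have h2 := is_derive1_comp (dc (- c) (Y t)) hY.
  set X' := derive1 X t in hX hE *; set Y' := derive1 Y t in hY h1 h2 *.
  have hP : is_derive t 1 P (4 * (q * E t * X') + c * expR (c * Y t) * Y' +
      - c * expR (- c * Y t) * Y').
    have := is_deriveD (is_deriveD (is_deriveZ 4 hE) h1) (is_deriveB h2 (is_derive_cst (2 : R) t 1)).
    rewrite subr0 => H.
    have -> : P = 4 *: ((fun u => expR (q * (u - x))) \o X) + ((fun u => expR (c * u)) \o Y) +
        (((fun u => expR (- c * u)) \o Y) - cst 2).
      by apply/funext => s; rewrite /P /= -addrA.
    exact: H.
  have hL : is_derive t 1 (ln (R:=R) \o P) ((P t)^-1 * (4 * (q * E t * X') +
      c * expR (c * Y t) * Y' + - c * expR (- c * Y t) * Y')).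
    apply: is_derive1_comp; apply: is_derive1_ln; exact: lt_le_trans (mP t).
  rewrite derive1E (@derive_val _ _ _ _ _ _ _ hL).
  have Pt : 0 < P t by exact: lt_le_trans (mP t).
  rewrite normrM gtr0_norm ?invr_gt0//.
  rewrite /u /arc_speed /= -/X' -/Y'; have [fX|fX] := eqVneq (f (X t)) 0.
    have [v0|v0] := eqVneq Y' 0; last by rewrite /= gt0_muley ?leey// lte_fin.
    rewrite /= v0 !mulr0 !addr0 mul0r expr0n addr0 sqrtr_sqr -EFinM lee_fin.
    rewrite ler_pdivrMl// !normrM (ger0_norm (_ : 0 <= 4))// (gtr0_norm q0) (gtr0_norm (expR_gt0 _)).
    rewrite [leLHS](_ : _ = (4 * E t) * (q * `|X'|)); last by rewrite /E; ring.
    rewrite ler_wpM2r ?mulr_ge0 ?(ltW q0)//.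
    by have := cosh2 (c * Y t); rewrite /P -mulNr; lra.
  rewrite /= -EFinM lee_fin ler_pdivrMl// [leRHS]mulrCA.
  have [w wE] : exists w, w = Y' / f (X t) by exists (Y' / f (X t)).
  have Y'E : Y' = w * f (X t) by rewrite wE mulfVK.
  rewrite -wE.
  pose e := expR (k x * (X t - x)).
  have eE : E t = e ^+ 2 by rewrite /E /e expr2 -expRD; congr expR; rewrite qE; ring.
  have e0 : 0 < e by exact: expR_gt0.
  have e1 : e <= 1 by rewrite -expR0 ler_expR mulr_ge0_le0 ?subr_le0// ltW.
  have Xt0 : 0 < X t.
    have /andP[] := Xr t; rewrite le_eqVlt => /predU1P[Xt0 _|//].
    by rewrite -Xt0 f0 eqxx in fX.
  have Xrho : 0 < X t < rho by rewrite Xt0 (le_lt_trans (Xx t))//; case/andP: xrho.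
  have fXe : f (X t) <= f x * e by exact: f_tangent.
  pose S := expR (c * Y t) - expR (- c * Y t).
  pose w2 := expR (c * Y t) + expR (- c * Y t).
  have SE : S ^+ 2 = w2 ^+ 2 - 4.
    have : expR (c * Y t) * expR (- c * Y t) = 1 by rewrite -expRD mulNr subrr expR0.
    move=> H; transitivity (w2 ^+ 2 - 4 * (expR (c * Y t) * expR (- c * Y t))).
      by rewrite /S /w2; ring.
    by rewrite H mulr1.
  have PE : P t = 4 * e ^+ 2 + w2 - 2 by rewrite /P eE /w2; ring.
  have w22 : 2 <= w2 by rewrite /w2 mulNr; exact: cosh2.
  have := calibration_ineq X' w (ltW e0) e1 w22 SE PE.
  rewrite -(ler_pM2l q0); apply: le_trans.
  rewrite (_ : _ + _ + _ = q * (4 * e ^+ 2 * X') + c * S * Y'); last first.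
    by rewrite eE /S; ring.
  apply: (le_trans (ler_normD _ _)); rewrite [leRHS]mulrDr; apply: lerD.
    rewrite normrM (gtr0_norm q0) normrM (ger0_norm (_ : 0 <= 4 * e ^+ 2))//.
    by rewrite mulr_ge0// sqr_ge0.
  rewrite Y'E !normrM (gtr0_norm c0) (gtr0_norm (f_gt0 Xrho)).
  rewrite (_ : q * _ = c * `|S| * (`|w| * (f x * e))); last first.
    by rewrite cE qE; field; rewrite gt_eqF.
  by rewrite ler_wpM2l ?mulr_ge0 ?(ltW c0)// ler_wpM2l.
have lnle : ln (P 1) <= ln (P 0) + q * r.
  have : (`|ln (P 1) - ln (P 0)|%:E <= (q * r)%:E)%E.
    apply: (le_trans key); rewrite EFinM lee_wpmul2l ?lee_fin ?(ltW q0)//.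
    exact: ltW.
  by rewrite lee_fin ler_norml => /andP[_]; rewrite lerBlDl.
have P0E : P 0 = m by rewrite /P /E X0 Y0 !mulr0 expR0 /m mulNr sub0r mulrN; ring.
have P1 : P 1 <= m * expR (q * r).
  have m0' : 0 < m * expR (q * r) by rewrite mulr_gt0 ?expR_gt0.
  rewrite -ler_ln ?posrE// ?(lt_le_trans m0)//.
  by rewrite lnM ?posrE ?expR_gt0// expRK -P0E.
have [D0 kD0] : 0 <= r - x /\ 0 <= k x * (r - x) by rewrite mulr_ge0 ?subr_ge0 ?(ltW kx).
have mr : m * expR (q * r) = 4 * expR (2 * (k x * (r - x))).
  by rewrite /m -mulrA -expRD; congr (_ * expR _); rewrite qE; ring.
have Y1e : expR (c * `|y|) <= P 1 + 2.
  rewrite /P Y1; have := expR_gt0 (c * y); have := expR_gt0 (- c * y).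
  have := expR_gt0 (q * (X 1 - x)); rewrite -/(E 1) => ? ? ?.
  by case: (ger0P y) => ?; rewrite ?mulrN -?mulNr; lra.
(* From [expR (c * |y|) <= 6 * expR (2 * (k x * (r - x)))]; halving the resulting 5 gives [5 / 2],
   rounded up to 3 in the statement. *)
have e5 : 6 <= expR (5 : R) by apply: le_trans (expR_ge1Dx _); lra.
have : c * `|y| <= 5 + 2 * (k x * (r - x)).
  rewrite -ler_expR expRD.
  have h1 : 1 <= expR (2 * (k x * (r - x))) by rewrite -expR0 ler_expR mulr_ge0.
  rewrite mr in P1; apply: (@le_trans _ _ (6 * expR (2 * (k x * (r - x))))); first lra.
  by rewrite ler_wpM2r// expR_ge0.
rewrite cE (_ : k x * `|y| / f x = k x / f x * `|y|); last by rewrite mulrAC.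
by rewrite -mulrA; lra.
Qed.

(** [half_path_height] asks for [X t <= x] at all times, whereas the intermediate value theorem
    gives it on [[0, 1]]; freezing the curve outside reconciles the two. *)
Lemma half_path_clamp x y X Y : half_path f r x y X Y ->
  half_path f r x y (X \o @unit_clamp R) (Y \o @unit_clamp R).
Proof.
move=> [[K [kX kY YK]] [X0 Y0 X1 Y1] Xr lr].
have K0 : 0 <= K by apply: le_trans (YK 0).
have c0 : unit_clamp 0 = 0 :> R by rewrite unit_clamp_id// lexx ler01.
have c1 : unit_clamp 1 = 1 :> R by rewrite unit_clamp_id// lexx ler01.
have kc h : klip K h -> klip K (h \o @unit_clamp R).
  by move=> kh; apply: klip_comp_clamp.
split; [|by rewrite /= c0 c1|by move=> t; exact: Xr|].
  by exists K; split; [exact: kc|exact: kc|move=> t; exact: YK].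
apply: le_lt_trans lr; rewrite -[leRHS]mul1e.
apply: (@graph_length_le _ _ _ _ _ _ K 1 set0) => //; [exact: kc|exact: kc|exact: negligible_set0|].
move=> t t01 _ _ _ _ _; rewrite mul1e.
have near01 (h : R -> R) : derive1 (h \o @unit_clamp R) t = derive1 h t.
  apply: near_eq_derive1; have := near_in_itvoo (_ : t \in `]0, 1[%R).
  rewrite in_itv/= => /(_ t01); apply: filterS => s.
  by rewrite in_itv/= => /andP[s0 s1]; rewrite /= unit_clamp_id// !ltW.
rewrite !near01 /= unit_clamp_id//.
by case/andP: t01 => ? ?; rewrite !ltW.
Qed.

(* Either the curve reaches abscissa [x] and can be pushed there, or it stays to
   the left of [x], where [f <= f x] bounds its height. *)
Lemma half_ball_rightward x1 y x z : half_ball f r (x1, y) -> x1 <= x -> x <= r ->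
  x <= z -> z < rho ->
  2 * (z - x) + f x / f z * (r - x + 3 / k x) < r - x ->
  half_ball f r (x, y).
Proof.
move=> /(half_ball_path f_even r_gt0)[x10 [X [Y hp]]] x1x xr xz zrho lr.
have x0 : 0 < x by exact: lt_le_trans x1x.
have xrho : 0 < x < rho by rewrite x0 (le_lt_trans xz).
have fx := f_gt0 xrho; have kx := k_gt0 xrho.
have fz : 0 < f z by rewrite f_gt0// zrho (lt_le_trans x0).
have [[t0 [t01 Xt0]]|nX] := pselect (exists t0, 0 <= t0 <= 1 /\ X t0 = x).
  exact: half_ball_push hp x10 x1x t01 Xt0.
have [[K [kX _ _]] [X0 _ _ _] _ _] := hp.
have Xx t : 0 <= t <= 1 -> X t <= x.
  move=> /andP[t0 t1]; rewrite leNgt; apply/negP => xX.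
  have [||c] := @IVT _ X 0 t x t0.
  - by apply: continuous_subspaceT; exact: klip_continuous kX.
  - by rewrite X0 min_l ?max_r ?(ltW (lt_trans x0 xX))// ltW//= ltW.
  rewrite in_itv/= => /andP[c0 ct] Xc; apply: nX; exists c.
  by rewrite c0 (le_trans ct).
have hh := half_path_height (half_path_clamp hp) x0 xr
  (fun t => Xx _ (unit_clamp_itv t)).
(* With the height bound, the hypothesis on [z] says exactly that the three-sided path through [z]
   is shorter than [r]. *)
apply: half_ball_rect xz zrho _ => //.
have hy : `|y| <= f x * (r - x + 3 / k x).
  rewrite [leLHS](_ : _ = f x / k x * (k x * `|y| / f x)); last by field; rewrite !gt_eqF.
  rewrite [leRHS](_ : _ = f x / k x * (k x * (r - x) + 3)); last by field; rewrite gt_eqF.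
  by rewrite ler_wpM2l// divr_ge0// ltW.
have : `|y| / f z <= f x / f z * (r - x + 3 / k x).
  by rewrite mulrAC ler_wpM2r// invr_ge0 ltW.
by move=> h; lra.
Qed.

(** * The core interval and the inequality on the half ball *)

Variables (m eps : R).
Hypothesis m_gt0 : 0 < m.
Hypothesis eps_gt0 : 0 < eps.
(** [1 / k] is the length scale on which [f] changes by a bounded factor; it must vary slowly and be
    at most of the order of the abscissa. *)
Hypothesis kV_lip : forall x y, 0 < x -> x <= y -> y < rho ->
  (k y)^-1 <= (k x)^-1 + m * (y - x).
Hypothesis kV_le : forall x, 0 < x < rho -> (k x)^-1 <= x / eps.
Hypothesis f_growth : forall x y, 0 < x -> x <= y -> y < rho ->
  ln (1 + m * k x * (y - x)) <= m * (ln (f y) - ln (f x)).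

Lemma half_ball_height x y : half_ball f r (x, y) -> `|y| <= 3 * (f r / k r).
Proof.
move=> /(half_ball_path f_even r_gt0)[x0 [X [Y hp]]].
have rr : 0 < r < rho by rewrite r_gt0.
have [_ _ Xr _] := hp.
have := half_path_height hp r_gt0 (lexx r) (fun t => ltW (andP (Xr t)).2).
rewrite subrr mulr0 add0r ler_pdivrMr ?f_gt0// => h.
by rewrite mulrA ler_pdivlMr ?k_gt0// mulrC.
Qed.

(** With [r - a = A / k a], the 3 ensures [3 / k x <= r - a] for [x <= a], and the second term makes
    a step of [(r - a) / 8] multiply [f] by at least 4. *)
Let A := 3 + 8 * expR (m * ln 4) / m.
(** With [a' = a - eta / k a], the first bound keeps [k a' <= 2 * k a] and the second keeps
    [a' >= a / 2]. *)
Let eta := Num.min (2 * m)^-1 (eps / 2).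

Let A3 : 3 <= A.
Proof. by rewrite /A lerDl divr_ge0 ?mulr_ge0 ?expR_ge0 ?(ltW m_gt0). Qed.

Let eta_gt0 : 0 < eta.
Proof. by rewrite /eta lt_min invr_gt0 !mulr_gt0. Qed.

(** Intermediate value theorem for [x + A / k x], which is continuous because [1 / k] is
    Lipschitz. *)
Lemma exists_core_abscissa : exists a, [/\ 0 < a < r & a + A * (k a)^-1 = r].
Proof.
have [rp rr] := (r_gt0, r_rho).
have A0 : 0 < A by apply: lt_le_trans A3.
(* Chosen so that [1 / k lo <= lo / eps] gives [lo + A / k lo <= r / 2]. *)
pose lo := r / (2 * (1 + A / eps)).
have e1 : 1 <= 1 + A / eps by rewrite lerDl divr_ge0 ?ltW.
have lo0 : 0 < lo by rewrite divr_gt0// mulr_gt0//; lra.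
have lor : lo < r.
  by rewrite /lo ltr_pdivrMr ?mulr_gt0//; [nra|lra].
pose g x := x + A * (k x)^-1.
(* [g] is controlled only on [[lo, r]]; composing with [p] and the clamp gives a function Lipschitz
   on the whole line. *)
pose p t := lo + t * (r - lo).
have pitv t : 0 <= t <= 1 -> lo <= p t <= r.
  by move=> /andP[t0 t1]; rewrite /p; nra.
have kV_mono x y : 0 < x -> x <= y -> y < rho -> (k x)^-1 <= (k y)^-1.
  move=> x0 xy yr; rewrite lef_pV2 ?posrE ?k_gt0//.
  - exact: k_nincr.
  - by rewrite x0 (le_lt_trans xy).
  - by rewrite yr (lt_le_trans x0).
pose K := (1 + A * m) * (r - lo).
have K0 : 0 <= K by rewrite mulr_ge0 ?subr_ge0 ?ltW// ltr_wpDl// mulr_gt0.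
have kG : klip K ((g \o p) \o @unit_clamp R).
  apply: klip_comp_clamp => // s t s01 t01 /=.
  wlog st : s t s01 t01 / s <= t.
    by move=> H; have [/H|/ltW/H] := leP s t; [exact|rewrite distrC (distrC t); exact].
  rewrite distrC (distrC s) (ger0_norm (_ : 0 <= t - s)) ?subr_ge0//.
  have pst : p s <= p t by rewrite lerD2l ler_wpM2r// subr_ge0 ltW.
  have /andP[ps _] := pitv _ s01; have /andP[_ pt] := pitv _ t01.
  have ps0 : 0 < p s by exact: lt_le_trans ps.
  have ptr : p t < rho by exact: le_lt_trans rr.
  have h1 := kV_mono _ _ ps0 pst ptr; have h2 := kV_lip ps0 pst ptr.
  have h3 : p t - p s = (t - s) * (r - lo) by rewrite /p; ring.
  rewrite ger0_norm; last by rewrite subr_ge0 lerD// ler_wpM2l// ltW.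
  have := ler_wpM2l (ltW A0) h2; rewrite mulrDr => h4.
  rewrite (_ : K * _ = (p t - p s) + A * (m * (p t - p s))); last by rewrite h3 /K; ring.
  by rewrite /g; lra.
have p0 : p 0 = lo by rewrite /p mul0r addr0.
have p1 : p 1 = r by rewrite /p mul1r subrKC.
have glo : g lo < r.
  have lorho : 0 < lo < rho by rewrite lo0 (lt_trans lor).
  have := ler_wpM2l (ltW A0) (kV_le lorho).
  rewrite (_ : A * (lo / eps) = lo * (A / eps)); last by ring.
  have : lo * (1 + A / eps) = r / 2.
    by rewrite /lo invfM mulrA mulfVK ?gt_eqF//; lra.
  by rewrite mulrDr mulr1 /g; lra.
have gr : r < g r.
  by rewrite /g ltrDl mulr_gt0// invr_gt0 k_gt0// r_gt0.
have c0 : unit_clamp 0 = 0 :> R by rewrite unit_clamp_id// lexx ler01.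
have c1 : unit_clamp 1 = 1 :> R by rewrite unit_clamp_id// lexx ler01.
have [||t] := @IVT _ ((g \o p) \o @unit_clamp R) 0 1 r ler01.
- by apply: continuous_subspaceT; exact: klip_continuous kG.
- by rewrite /= c0 c1 p0 p1 min_l ?max_r ?(ltW (lt_trans glo gr))// (ltW glo) ltW.
rewrite in_itv/= => t01; rewrite /= unit_clamp_id// => gt.
have /andP[plo pr] := pitv _ t01.
exists (p t); split => //; rewrite (lt_le_trans lo0 plo)/= lt_neqAle pr andbT.
by apply/eqP => ptr; move: gr; rewrite -{1}gt ptr ltxx.
Qed.

(** All lengths involved, [a - a'], [r - a] and [1 / k r], are comparable to [1 / k a], with
    constants that depend only on [m] and [eps]. *)
Lemma half_ball_core : exists a' a, [/\ [/\ 0 < a', a' < a & a < r],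
    (forall x1 x y, half_ball f r (x1, y) -> x1 <= x -> x <= a ->
       half_ball f r (x, y)),
    f r <= expR (2 * (A + eta)) * f a' &
    f r / k r <= expR (2 * (A + eta)) * (1 + m * A) / eta * f a' * (a - a')].
Proof.
have [rp rr] := (r_gt0, r_rho).
have A0 : 0 < A by apply: lt_le_trans A3.
have [a [/andP[a0 ar] aE]] := exists_core_abscissa.
have arho : 0 < a < rho by rewrite a0 (lt_trans ar).
have ka := k_gt0 arho.
have raE : r - a = A * (k a)^-1 by rewrite -aE; ring.
pose u := eta / k a; have u0 : 0 < u by rewrite divr_gt0.
have ua : u <= a / 2.
  have h := kV_le arho.
  apply: (@le_trans _ _ (eps / 2 * (a / eps))); last first.
    by rewrite le_eqVlt; apply/orP; left; apply/eqP; field; rewrite gt_eqF.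
  apply: ler_pM => //; [exact: ltW|by rewrite invr_ge0 ltW|].
  by rewrite ge_min lexx orbT.
have a'0 : 0 < a - u by lra.
have a'rho : 0 < a - u < rho by rewrite a'0/=; lra.
have ka' : k (a - u) <= 2 * k a.
  have := kV_lip a'0 (_ : a - u <= a) (lt_trans ar rr).
  rewrite lerBlDr lerDl => /(_ (ltW u0)) h.
  have mu2 : m * u <= (k a)^-1 / 2.
    rewrite /u mulrA mulrC ler_wpM2l ?invr_ge0 ?(ltW ka)//.
    apply: (@le_trans _ _ (m * (2 * m)^-1)).
      by rewrite ler_wpM2l ?(ltW m_gt0)// ge_min lexx.
    by rewrite invfM mulrCA mulfV ?gt_eqF// mulr1.
  have : (2 * k a)^-1 <= (k (a - u))^-1.
    rewrite (_ : a - (a - u) = u) in h; last by ring.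
    by rewrite invfM; lra.
  by rewrite lef_pV2 ?posrE ?k_gt0 ?mulr_gt0.
(* The tangent at [a - u] costs [k (a - u) * (r - a + u)], at most [2 * k a * ((A + eta) / k a)]. *)
have fra : f r <= expR (2 * (A + eta)) * f (a - u).
  rewrite mulrC; apply: (le_trans (f_tangent a'rho _)); first by rewrite r_gt0.
  rewrite ler_wpM2l ?(ltW (f_gt0 a'rho))// ler_expR.
  apply: (@le_trans _ _ (2 * k a * (r - (a - u)))).
    by rewrite ler_wpM2r// subr_ge0; lra.
  rewrite (_ : r - (a - u) = (r - a) + u); last by ring.
  rewrite raE /u (_ : _ * _ = 2 * (A + eta)) //.
  by field; rewrite gt_eqF.
exists (a - u), a; split => //.
- by split => //; lra.
- move=> x1 x y h x1x xa.
  have /andP[x10 x1r] := half_ball_x_itv h.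
  have x0 : 0 < x by exact: lt_le_trans x1x.
  have xrho : 0 < x < rho by rewrite x0; lra.
  have kx := k_gt0 xrho.
  have kax : k a <= k x by apply: k_nincr => //; case/andP: arho.
  (* The detour goes to [z = x + s], with [s] an eighth of [r - a]. *)
  pose s := A / (8 * k a).
  have s0 : 0 < s by rewrite divr_gt0// mulr_gt0.
  have s8 : 8 * s = r - a by rewrite raE /s; field; rewrite gt_eqF.
  have zrho : x + s < rho by lra.
  apply: (half_ball_rightward h x1x _ _ zrho); [lra|lra|].
  have fx := f_gt0 xrho.
  have fz : 0 < f (x + s) by rewrite f_gt0// zrho andbT; lra.
  have q4 : f x / f (x + s) <= 4^-1.
    have := f_growth x0 (_ : x <= x + s) zrho; rewrite lerDl => /(_ (ltW s0)).
    rewrite (_ : x + s - x = s); last by ring.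
    have h1 : m * ln 4 <= ln (1 + m * k x * s).
      rewrite -[leLHS]expRK ler_ln ?posrE ?expR_gt0//; last first.
        by apply: ltr_pwDl => //; apply: mulr_ge0 (ltW s0); rewrite mulr_ge0// ltW.
      apply: (@le_trans _ _ (m * k a * s)).
        rewrite /s (_ : m * k a * _ = m * A / 8); last by field; rewrite gt_eqF.
        rewrite /A mulrDr (_ : m * (8 * _ / m) = 8 * expR (m * ln 4)).
          by have := mulr_gt0 m_gt0 (ltr0Sn R 2); lra.
        by field; rewrite gt_eqF.
      rewrite -[leLHS]add0r; apply: lerD => //.
      by rewrite ler_wpM2r ?(ltW s0)// ler_wpM2l// ltW.
    move=> h2; have := le_trans h1 h2; rewrite ler_pM2l// -ln_div ?posrE//.
    rewrite ler_ln ?posrE ?divr_gt0// => h3.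
    by rewrite -[leLHS]invrK invf_div lef_pV2 ?posrE ?divr_gt0.
  have kxa : 3 / k x <= r - a.
    rewrite raE; apply: ler_pM => //; first by rewrite invr_ge0 ltW.
    by rewrite lef_pV2.
  have D0 : 0 < r - x by lra.
  (* The two horizontal excesses cost [(r - a) / 4] and the climb at most [(r - x) / 2]: together
     less than [r - x]. *)
  apply: (@le_lt_trans _ _ (2 * s + 4^-1 * (r - x + (r - x)))).
    rewrite (_ : x + s - x = s); last by ring.
    rewrite lerD2l; apply: ler_pM => //.
    - by rewrite divr_ge0 ?ltW.
    - by rewrite addr_ge0 ?divr_ge0 ?(ltW D0) ?(ltW kx).
    - by rewrite lerD2l; lra.
  by lra.
(* Slow variation of [1 / k] gives [1 / k r <= (1 + m * A) / k a], and [1 / k a = u / eta]. *)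
- rewrite (_ : a - (a - u) = u); last by ring.
  have := kV_lip a0 (ltW ar) rr; rewrite raE => h.
  rewrite (_ : _ * u = (expR (2 * (A + eta)) * f (a - u)) * ((k a)^-1 + m * (A / k a))).
    apply: ler_pM => //; first by rewrite ltW// f_gt0// r_gt0.
    by rewrite invr_ge0 ltW// k_gt0// r_gt0.
  by rewrite /u; field; rewrite !gt_eqF.
Qed.

(** Free of [r]. The first term is that of [planar_poincare]; each of its two height terms
    contributes 12, which is 4 times the 3 of the height bound. *)
Definition poincare_constant : R :=
  2 * (1 + expR (2 * (A + eta))) +
  24 * (expR (2 * (A + eta)) * (1 + m * A) / eta).

Lemma half_ball_poincare (w : R * R -> R) : [lipschitz w p | p in half_ball f r] ->
  (\int[lebesgue2 R]_(p in half_ball f r)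
      `|w p - average (half_ball f r) w|%:E
    <= (poincare_constant * r)%:E *
       \int[lebesgue2 R]_(p in half_ball f r)
          (euclid_norm (gradA f w p))%:E)%E.
Proof.
move=> /pinfty_ex_gt0[M M0 wM].
have wM' p q : half_ball f r p -> half_ball f r q -> `|w p - w q| <= M * `|p - q|.
  by move=> Op Oq; exact: (wM (p, q)).
(* [planar_poincare] is applied to the extension [W]; the half ball is open, so [W] and [w] have the
   same gradient on it. *)
have [W [W_lip Ww]] := lipschitz_extension (ltW M0) wM'.
have Ww' p : half_ball f r p -> W p = w p by move=> Op; apply: Ww; rewrite inE.
have [a' [a [[a'0 a'a ar] Om_right fr fkr]]] := half_ball_core.
have [rp rr] := (r_gt0, r_rho).
have rrho : 0 < r < rho by rewrite r_gt0.
(* One constant serves twice: it bounds [f r / f a'], and dividing the height by it pays for a move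
   to the left as far as [a']. *)
set kap := expR (2 * (A + eta)) in fr fkr.
have kap1 : 1 <= kap.
  by rewrite -expR0 ler_expR mulr_ge0// addr_ge0 ?(ltW eta_gt0)// (le_trans _ A3).
have kap0 : 0 < kap by exact: lt_le_trans kap1.
have a'r : 0 < a' < rho by rewrite a'0 (lt_trans a'a)// (lt_trans ar).
have fa'0 : 0 < f a' := f_gt0 a'r.
have kr0 : 0 < k r := k_gt0 rrho.
pose H := 3 * (f r / k r).
have H0 : 0 <= H by rewrite mulr_ge0// divr_ge0 ?ltW// f_gt0.
have Om_shrink x x' y : half_ball f r (x, y) -> a' < x' -> x' <= x ->
    half_ball f r (x', kap^-1 * y).
  move=> h a'x' x'x; have /andP[x0 xr] := half_ball_x_itv h.
  rewrite -(min_r x'x); apply: (half_ball_min (c := kap) h) => //.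
  - by rewrite (lt_trans a'0)//= (le_lt_trans x'x)// (lt_trans xr).
  - move=> z /andP[x'z zr]; apply: (@le_trans _ _ (f r)).
      by apply: f_homo => //; [rewrite (le_trans _ x'z)// ltW// (lt_trans a'0)|exact: ltW].
    apply: (le_trans fr); rewrite ler_pM2l//; apply: f_homo => //; try exact: ltW.
    by rewrite (le_lt_trans x'x)// (lt_trans xr).
  - by rewrite gtr0_norm ?invr_gt0// mulVf// gt_eqF.
have f_ge x : a' < x < r -> f a' <= f x.
  move=> /andP[ax xr]; apply: f_homo; [exact: ltW|exact: ltW|exact: lt_trans rr].
have := planar_poincare half_ball_open half_ball_x_itv half_ball_height
  half_ball_scale Om_right Om_shrink a'0 a'a ar kap1 H0 W_lip fa'0 f_ge.
have avgE : average (half_ball f r) W = average (half_ball f r) w.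
  rewrite /average; congr (_ * fine _).
  by apply: eq_integral => p /[!inE] Op; rewrite Ww'.
have -> : (\int[lebesgue2 R]_(p in half_ball f r)
      `|W p - average (half_ball f r) W|%:E =
    \int[lebesgue2 R]_(p in half_ball f r)
      `|w p - average (half_ball f r) w|%:E)%E.
  by apply: eq_integral => p /[!inE] Op; rewrite avgE Ww'.
have -> : (\int[lebesgue2 R]_(p in half_ball f r) (euclid_norm (gradA f W p))%:E =
    \int[lebesgue2 R]_(p in half_ball f r) (euclid_norm (gradA f w p))%:E)%E.
  apply: eq_integral => -[x y] /[!inE] Op; rewrite /gradA /=.
  have [[P Q] /= [nP nQ] PQ] := half_ball_nbhs Op.
  congr ((euclid_norm (_, _ * _))%:E); apply: near_eq_derive1.
    apply: filterS nP => s Ps; apply/Ww'/PQ; split => //=; exact: nbhs_singleton.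
  apply: filterS nQ => s Qs; apply/Ww'/PQ; split => //=; exact: nbhs_singleton.
move/le_trans; apply; apply: lee_wpmul2r.
  by apply: integral_ge0 => p _; rewrite lee_fin sqrtr_ge0.
rewrite lee_fin /poincare_constant -/kap.
set C1 := kap * (1 + m * A) / eta in fkr *.
have C10 : 0 <= C1.
  rewrite mulr_ge0 ?invr_ge0 ?(ltW eta_gt0)// mulr_ge0 ?(ltW kap0)// addr_ge0//.
  by rewrite mulr_ge0 ?(ltW m_gt0)// (le_trans _ A3).
have HC : H <= 3 * C1 * (f a' * (a - a')).
  by rewrite /H -mulrA ler_pM2l// mulrA.
have u0 : 0 < a - a' by rewrite subr_gt0.
have ur : a - a' <= r by move: a'0 ar; lra.
have e1 : 4 * H / f a' <= 12 * C1 * r.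
  rewrite ler_pdivrMr//; apply: (@le_trans _ _ (12 * C1 * (f a' * (a - a')))).
    by move: HC; lra.
  have -> : 12 * C1 * r * f a' = 12 * C1 * (f a' * r) by ring.
  by apply: ler_wpM2l; [exact: mulr_ge0|apply: ler_wpM2l => //; exact: ltW].
have e2 : 4 * H * r / (a - a') / f a' <= 12 * C1 * r.
  rewrite -mulrA -invfM ler_pdivrMr; last by rewrite mulr_gt0.
  have -> : 12 * C1 * r * ((a - a') * f a') = 4 * (3 * C1 * (f a' * (a - a'))) * r by ring.
  by rewrite ler_wpM2r ?(ltW rp)// ler_wpM2l.
rewrite -/H [(4 * H + _) / f a']mulrDl.
by apply: (le_trans (lerD (lexx _) (lerD e1 e2))); lra.
Qed.

End half_ball_geometry.

(** * Convex exponents *)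

Section convex_exponent.
Variables (R : realType) (F : R -> R) (rho eps c : R).
Hypothesis eps_gt0 : 0 < eps.
Hypothesis c_gt0 : 0 < c.
Hypothesis F_derivable : forall x, 0 < x < rho -> derivable F x 1.
Hypothesis F'_derivable : forall x, 0 < x < rho -> derivable (derive1 F) x 1.
Hypothesis F'_lt0 : forall x, 0 < x < rho -> derive1 F x < 0.
Hypothesis F''_ge0 : forall x, 0 < x < rho -> 0 <= derive1 (derive1 F) x.
Hypothesis F'_bound : forall x, 0 < x < rho -> 1 / (- (x * derive1 F x)) <= 1 / eps.
Hypothesis F''_le : forall x, 0 < x < rho ->
  derive1 (derive1 F) x / (- derive1 F x) <= c * (1 / x).

Let k x := - derive1 F x.

Let k_gt0 x : 0 < x < rho -> 0 < k x.
Proof. by move=> xr; rewrite oppr_gt0 F'_lt0. Qed.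

Let dF x : 0 < x < rho -> is_derive x 1 F (- k x).
Proof.
by move=> xr; rewrite opprK derive1E; apply: derivableP; exact: F_derivable.
Qed.

Let dk x : 0 < x < rho -> is_derive x 1 k (- derive1 (derive1 F) x).
Proof.
move=> xr; have h : is_derive x 1 (derive1 F) (derive1 (derive1 F) x).
  by rewrite (derive1E (derive1 F)); apply: derivableP; exact: F'_derivable.
exact: is_deriveN.
Qed.

Let sub_itv a b x : 0 < a -> b < rho -> a <= x <= b -> 0 < x < rho.
Proof.
by move=> a0 br /andP[ax xb]; rewrite (lt_le_trans a0)//= (le_lt_trans xb).
Qed.

Let k_nincr a b : 0 < a -> a <= b -> b < rho -> k b <= k a.
Proof.
move=> a0 ab br; have [|z zab e] := @mean_value R k (fun x => - derive1 (derive1 F) x) a b ab.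
  by move=> x xab; apply/dk/(sub_itv a0 br xab).
rewrite -subr_le0 e mulNr oppr_le0 mulr_ge0 ?subr_ge0//.
exact/F''_ge0/(sub_itv a0 br zab).
Qed.

(** Mean value theorem on either side of [a], with [k] nonincreasing. *)
Lemma convex_exponent_tangent a b : 0 < a < rho -> 0 < b < rho ->
  F a - k a * (b - a) <= F b.
Proof.
move=> /andP[a0 ar] /andP[b0 br]; have [ab|ba] := leP a b.
  have [|z zab e] := @mean_value R F (fun x => - k x) a b ab.
    by move=> x xab; apply/dF/(sub_itv a0 br xab).
  have /andP[az zb] := zab.
  have : k z <= k a by apply: k_nincr => //; rewrite (le_lt_trans zb).
  by move: e; have : 0 <= b - a by [rewrite subr_ge0]; nra.
have [|z zab e] := @mean_value R F (fun x => - k x) b a (ltW ba).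
  by move=> x xab; apply/dF/(sub_itv b0 ar xab).
have /andP[bz za] := zab.
have : k a <= k z by apply: k_nincr => //; rewrite (lt_le_trans b0).
by move: e; have : 0 <= a - b by [rewrite subr_ge0 ltW]; nra.
Qed.

Lemma convex_exponent_kV_le x : 0 < x < rho -> (k x)^-1 <= x / eps.
Proof.
move=> xr; have kx := k_gt0 xr; have /andP[x0 _] := xr.
by move: (F'_bound xr); rewrite !div1r -mulrN invfM ler_pdivrMl.
Qed.

(** The derivative of [1 / k] is [(F'' / k) * (1 / k)], at most [(c / z) * (z / eps) = c / eps]. *)
Lemma convex_exponent_kV_lip x y : 0 < x -> x <= y -> y < rho ->
  (k y)^-1 <= (k x)^-1 + c / eps * (y - x).
Proof.
move=> x0 xy yr.
have [|z zxy e] := @mean_value R (fun t => (k t)^-1)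
    (fun t => - (k t) ^- 2 *: (- derive1 (derive1 F) t)) x y xy.
  move=> t /(sub_itv x0 yr) tr; apply: is_deriveV; last exact: dk.
  by rewrite gt_eqF// k_gt0.
rewrite -lerBlDl e ler_wpM2r ?subr_ge0//.
have zr := sub_itv x0 yr zxy; have /andP[z0 _] := zr.
have kz := k_gt0 zr.
rewrite /GRing.scale/= mulrNN.
have -> : (k z ^+ 2)^-1 * derive1 (derive1 F) z =
    derive1 (derive1 F) z / k z * (k z)^-1 by rewrite expr2 invfM; ring.
have -> : c / eps = c * (1 / z) * (z / eps) by field; rewrite !gt_eqF.
apply: ler_pM; [|by rewrite invr_ge0 ltW|exact: F''_le|exact: convex_exponent_kV_le].
by rewrite divr_ge0 ?F''_ge0// ltW.
Qed.

(** Integrated form of the Lipschitz bound: that bound says that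
    [m * F t + ln (1 + m * k x * (t - x))] has nonpositive derivative for [t >= x]. *)
Lemma convex_exponent_growth x y : 0 < x -> x <= y -> y < rho ->
  ln (1 + c / eps * k x * (y - x)) <= c / eps * (F x - F y).
Proof.
move=> x0 xy yr; have m0 : 0 < c / eps by rewrite divr_gt0.
set m := c / eps in m0 *.
have kx : 0 < k x by apply: k_gt0; rewrite x0 (le_lt_trans xy).
have L0 t : x <= t -> 0 < 1 + m * k x * (t - x).
  by move=> xt; rewrite ltr_pwDl// mulr_ge0 ?subr_ge0// mulr_ge0 ?ltW.
have [|z zxy] := @mean_value R (fun t => m * F t + ln (1 + m * k x * (t - x)))
    (fun t => m * (- k t) + (1 + m * k x * (t - x))^-1 * (m * k x)) x y xy.
  move=> t txy; have tr := sub_itv x0 yr txy; have /andP[xt _] := txy.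
  have dFt := dF tr.
  have dl : is_derive t 1 (fun t => 1 + m * k x * (t - x)) (m * k x).
    by apply: is_derive_eq; rewrite /GRing.scale/=; ring.
  have dln := is_derive1_ln (L0 _ xt).
  exact: is_deriveD.
have /andP[xz zy] := zxy; have zr := sub_itv x0 yr zxy.
rewrite subrr mulr0 addr0 ln1 addr0 => e.
suff : m * (- k z) + (1 + m * k x * (z - x))^-1 * (m * k x) <= 0.
  by move: e; have : 0 <= y - x by [rewrite subr_ge0]; nra.
rewrite mulrN addrC subr_le0 ler_pdivrMl ?L0//.
have kz := k_gt0 zr; have /andP[_ zrho] := zr.
have := convex_exponent_kV_lip x0 xz zrho; rewrite -/m => h.
rewrite [leRHS]mulrCA ler_pM2l//.
have -> : (1 + m * k x * (z - x)) * k z = k x * k z * ((k x)^-1 + m * (z - x)).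
  by field; rewrite gt_eqF.
by rewrite -ler_pdivrMl ?mulr_gt0// invfM mulrAC mulVf ?mul1r// gt_eqF.
Qed.

End convex_exponent.

Theorem proposition87 (R : realType) (f F : R -> R) (rho C0 eps : R)
  (rho_gt0 : 0 < rho) (C0_ge1 : 1 <= C0) (eps_gt0 : 0 < eps)
  (f_even : forall x, f (- x) = f x)
  (f0 : f 0 = 0)
  (f_expF : forall x, 0 < `|x| < rho -> f x = expR (- F `|x|))
  (F_derivable : forall x, 0 < x < rho -> derivable F x 1)
  (F'_derivable : forall x, 0 < x < rho -> derivable (derive1 F) x 1)
  (F_lim : F x @[x --> 0^'+] --> +oo)
  (F'_lt0 : forall x, 0 < x < rho -> derive1 F x < 0)
  (F''_gt0 : forall x, 0 < x < rho -> 0 < derive1 (derive1 F) x)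
  (F'_doubling : forall r x, r / 2 < x -> x < 2 * r -> 2 * r < rho ->
     C0^-1 * `|derive1 F r| <= `|derive1 F x| <= C0 * `|derive1 F r|)
  (F'_incr : forall x y, 0 < x -> x <= y -> y < rho ->
     1 / (- (x * derive1 F x)) <= 1 / (- (y * derive1 F y)))
  (F'_bound : forall x, 0 < x < rho -> 1 / (- (x * derive1 F x)) <= 1 / eps)
  (F''_approx : exists2 c : R, 0 < c & forall x, 0 < x < rho ->
     c^-1 * (1 / x) <= derive1 (derive1 F) x / (- derive1 F x) <= c * (1 / x)) :
  exists C : R, \forall r \near 0^'+,
    forall w : R * R -> R, [lipschitz w p | p in half_ball f r] ->
      (\int[lebesgue2 R]_(p in half_ball f r)
          (`|w p - average (half_ball f r) w|)%:E
        <= (C * r)%:E *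
           \int[lebesgue2 R]_(p in half_ball f r)
              (euclid_norm (gradA f w p))%:E)%E.
Proof.
have [c c0 F''c] := F''_approx.
have F''_ge0 x : 0 < x < rho -> 0 <= derive1 (derive1 F) x.
  by move=> xr; exact/ltW/F''_gt0.
have F''_le x : 0 < x < rho ->
    derive1 (derive1 F) x / (- derive1 F x) <= c * (1 / x).
  by move=> /F''c/andP[].
have fE x : 0 < x < rho -> f x = expR (- F x).
  by move=> xr; rewrite f_expF ?gtr0_norm//; case/andP: xr.
have f_gt0 x : 0 < x < rho -> 0 < f x by move=> /fE ->; exact: expR_gt0.
have k_gt0 x : 0 < x < rho -> 0 < - derive1 F x by move=> xr; rewrite oppr_gt0 F'_lt0.
have f_tangent a b : 0 < a < rho -> 0 < b < rho ->
    f b <= f a * expR (- derive1 F a * (b - a)).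
  move=> ar br; rewrite !fE// -expRD ler_expR.
  have := convex_exponent_tangent F_derivable F'_derivable F''_ge0 ar br; lra.
have f_growth x y : 0 < x -> x <= y -> y < rho ->
    ln (1 + c / eps * - derive1 F x * (y - x)) <= c / eps * (ln (f y) - ln (f x)).
  move=> x0 xy yr; rewrite !fE ?x0 ?(lt_le_trans x0 xy) ?(le_lt_trans xy yr)// !expRK.
  rewrite opprK [- F y + _]addrC.
  exact: (convex_exponent_growth eps_gt0 c0 F_derivable F'_derivable F'_lt0
            F''_ge0 F'_bound F''_le).
(* The slope of [1 / k] is [m = c / eps], so the constant depends only on [c] and [eps]. *)
exists (poincare_constant (c / eps) eps); near=> r => w.
have r0 : 0 < r by near: r; exact: nbhs_right_gt.
have rrho : r < rho by near: r; exact: nbhs_right_lt.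
apply: (half_ball_poincare f_even f0 f_gt0 k_gt0 f_tangent r0 rrho
  (divr_gt0 c0 eps_gt0) eps_gt0 _ _ f_growth).
- exact: (convex_exponent_kV_lip eps_gt0 F'_derivable F'_lt0 F''_ge0 F'_bound F''_le).
- exact: (convex_exponent_kV_le F'_lt0 F'_bound).
Unshelve. all: by end_near.
Qed.
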